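(* Let $q,\alpha\in[0,1]$, $\gamma\in(0,1)$ and $\beta\in(0,0.5]$ satisfy $\gamma\le1-\alpha(1-H_b(\beta))$, and consider the secure ISAC model with full secrecy and perfect output feedback for the BEC-BSC ISAC channel with state-dependent inputs with these parameters and with Hamming distortion metrics (this ISAC channel is more-capable). Then $\mathcal R_{\mathrm{POF}}$ includes the union over all $p\in[0,1]$ of the tuples $(R,D_1,D_2)$ with $R\ge0$ satisfying $$R\le q\big(H_b(p)(1-\gamma)+\alpha(H_b(\beta)-H_b(p*\beta))\big),$$ $$D_1\ge(1-p+p\gamma)\cdot\min\{q,\,1-q\},$$ $$D_2\ge(1-p)\cdot\min\{q\alpha,\,1-q\alpha\}+p\cdot\begin{cases}q\alpha&\text{if } q\alpha\le\beta,\\ (q\alpha*\beta*q\alpha)&\text{if }\beta<q\alpha\le1-\beta,\\ 1-q\alpha&\text{if } q\alpha>1-\beta.\end{cases}$$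
   Context: Notation: $H_b(x)=-x\log x-(1-x)\log(1-x)$ is the binary entropy function; $I$ denotes mutual information; all logarithms are natural. $a*b=a(1-b)+(1-a)b$ (an associative operation); in $q\alpha*\beta$ the product $q\alpha$ is taken first. $\mathrm{BEC}(\gamma)$ is the binary erasure channel with erasure probability $\gamma$ and erasure symbol $\mathtt e$; $\mathrm{BSC}(\beta)$ is the binary symmetric channel with crossover probability $\beta$. $\mathrm{Bern}(p)$ is the Bernoulli law with success probability $p$. The Hamming distortion is $d(s,\hat s)=1$ if $s\ne\hat s$ and $0$ otherwise. BEC-BSC ISAC channel with state-dependent inputs: $\mathcal X=\mathcal S_j=\widehat{\mathcal S}_j=\{0,1\}$; the binary state pair has law $P_{S_1S_2}(0,0)=1-q$, $P_{S_1S_2}(1,1)=q\alpha$, $P_{S_1S_2}(0,1)=0$, $P_{S_1S_2}(1,0)=q(1-\alpha)$; $X\sim\mathrm{Bern}(p)$ denotes a binary input independent of $(S_1,S_2)$. Set $\bar X_1=S_1\cdot X$ and $\bar X_2=S_2\cdot X$. The output $Y_1\in\{0,1,\mathtt e\}$ is obtained by passing $\bar X_1$ through a $\mathrm{BEC}(\gamma)$, and $Y_2\in\{0,1\}$ by passing $\bar X_2$ through a $\mathrm{BSC}(\beta)$, so that $Y_1-(S_1,X)-(Y_2,S_2)$ and $Y_2-(S_2,X)-(Y_1,S_1)$ form Markov chains. An ISAC channel is more-capable if $I(X;Y_1,S_1)\ge I(X;Y_2,S_2)$ for all $P_X$. Model (secure ISAC, i.e. integrated sensing and communication, with full secrecy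 and perfect output feedback). The state pairs $(S_{1,i},S_{2,i})$, $i=1,\dots,n$, are i.i.d. with known law $P_{S_1S_2}$. The channel $P_{Y_1Y_2|S_1S_2X}$ is known and memoryless. The message $M$ is uniform on $\mathcal M$ and independent of the states. The transmitter computes the channel inputs as $X_i=\mathsf{Enc}_i(M,Z^{i-1})\in\mathcal X$ for $i=1,\dots,n$, where $\mathsf{Enc}_i(\cdot)$ is an encoding function and $Z^{i-1}$ is the delayed channel output feedback, with $Z_{i}=(Y_{1,i},Y_{2,i})$ (perfect output feedback). The legitimate receiver observes $(Y_1^n,S_1^n)$ and forms $\widehat M=\mathsf{Dec}(Y_1^n,S_1^n)$, where $\mathsf{Dec}(\cdot)$ is a decoding function. The eavesdropper observes $(Y_2^n,S_2^n)$. The transmitter forms state estimates $\widehat{S_j^n}=\mathsf{Est}_j(X^n,Y_1^n,Y_2^n)\in\widehat{\mathcal S}_j^n$, $j=1,2$. For per-letter distortion metrics $d_j$, $d_j(s^n,\widehat{s^n})=\frac1n\sum_{i=1}^n d_j(s_i,\widehat s_i)$. Achievability. A tuple $(R,D_1,D_2)$ with $R\ge0$ is achievable if, for every $\delta>0$, there exist $n\ge1$, an encoder, a decoder and two estimators such that: $\frac1n\log|\mathcal M|\ge R-\delta$; $\Pr[M\ne\widehat M]\le\delta$; $I(M;Y_2^n|S_2^n)\le\delta$; and $\mathbb E[d_j(S_j^n,\widehat{S_j^n})]\le D_j+\delta$ for $j=1,2$. The region $\mathcal R_{\mathrm{POF}}$ is the closure of the set of all achievable tuples.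
   Formalization: The encoder Enc_i may also use local randomness independent of message, states and channel noise (stochastic encoding); with Enc_i a deterministic function of (M, Z^{i-1}) the claim fails, e.g. for q=α=1, p=1/2, fixed β<1/2 and small γ. *)

(* Defs.v *)
From HB Require Import structures.
From mathcomp Require Import all_boot all_order all_algebra.
From mathcomp Require Import all_classical all_reals all_analysis.
From mathcomp Require Import ring.
Import Order.TTheory GRing.Theory Num.Theory.
Import numFieldNormedType.Exports.

Set Implicit Arguments.
Unset Strict Implicit.
Unset Printing Implicit Defensive.

Local Open Scope classical_set_scope.
Local Open Scope ring_scope.

Definition is_pmf (R : realType) (T : finType) (P : T -> R) : Prop :=
  (forall t, 0 <= P t) /\ \sum_t P t = 1.

Definition Pr (R : realType) (O : finType) (P : O -> R) (E : pred O) : R :=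
  \sum_(w | E w) P w.

Definition Expect (R : realType) (O : finType) (P : O -> R) (f : O -> R) : R :=
  \sum_w P w * f w.

(* Since [0 * _ = 0], terms of probability zero do not contribute, whatever the
   value of the (totalized) logarithm and quotient. *)
Definition mutual_info (R : realType) (O A B : finType) (P : O -> R)
    (X : O -> A) (Y : O -> B) : R :=
  \sum_a \sum_b
    let pab := Pr P [pred w | (X w == a) && (Y w == b)] in
    pab * ln (pab / (Pr P [pred w | X w == a] * Pr P [pred w | Y w == b])).

Definition cond_mutual_info (R : realType) (O A B C : finType) (P : O -> R)
    (X : O -> A) (Y : O -> B) (Z : O -> C) : R :=
  \sum_a \sum_b \sum_c
    let pabc := Pr P [pred w | [&& X w == a, Y w == b & Z w == c]] in
    pabc * ln (pabc * Pr P [pred w | Z w == c] /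
               (Pr P [pred w | (X w == a) && (Z w == c)] *
                Pr P [pred w | (Y w == b) && (Z w == c)])).

Definition Hb (R : realType) (x : R) : R :=
  - x * ln x - (1 - x) * ln (1 - x).

Definition bconv (R : realType) (a b : R) : R := a * (1 - b) + (1 - a) * b.

Record isac_channel (R : realType) (X S1 S2 Y1 Y2 : finType) := IsacChannel {
  state_law : S1 * S2 -> R;
  output_law : S1 * S2 -> X -> Y1 * Y2 -> R;
  state_lawP : is_pmf state_law;
  output_lawP : forall s x, is_pmf (output_law s x)
}.

Definition single_letter_law (R : realType) (X S1 S2 Y1 Y2 : finType)
    (ch : isac_channel R X S1 S2 Y1 Y2) (PX : X -> R)
    (w : X * (S1 * S2) * (Y1 * Y2)) : R :=
  let: (x, s, y) := w in PX x * state_law ch s * output_law ch s x y.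

Definition more_capable (R : realType) (X S1 S2 Y1 Y2 : finType)
    (ch : isac_channel R X S1 S2 Y1 Y2) : Prop :=
  forall PX : X -> R, is_pmf PX ->
    let P := single_letter_law ch PX in
    mutual_info P (fun w => w.1.1) (fun w => (w.2.2, w.1.2.2)) <=
    mutual_info P (fun w => w.1.1) (fun w => (w.2.1, w.1.2.1)).

(* A code of blocklength [n].  The encoder is stochastic, as usual in wiretap
   coding: its local randomness has law [rnd_law] on a finite set and is
   independent of the message, of the states and of the channel noise.  The
   input at time [i] is [enc i m r z'] with [z'] the feedback received strictly
   before time [i]; see [inputs]. *)
Record isac_code (R : realType) (X S1 S2 T1 T2 Y1 Y2 : finType) (n : nat) :=
  IsacCode {
    msg : finType;
    msg_gt0 : (0 < #|msg|)%N;
    rnd : finType;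
    rnd_law : rnd -> R;
    rnd_lawP : is_pmf rnd_law;
    enc : 'I_n -> msg -> rnd -> seq (Y1 * Y2) -> X;
    dec : n.-tuple Y1 -> n.-tuple S1 -> msg;
    est1 : n.-tuple X -> n.-tuple Y1 -> n.-tuple Y2 -> n.-tuple T1;
    est2 : n.-tuple X -> n.-tuple Y1 -> n.-tuple Y2 -> n.-tuple T2
  }.
Arguments rnd_law {R X S1 S2 T1 T2 Y1 Y2 n} _ _.
Arguments enc {R X S1 S2 T1 T2 Y1 Y2 n} _ _ _ _ _.

Section Code.
Context (R : realType) (X S1 S2 T1 T2 Y1 Y2 : finType) (n : nat).
Context (ch : isac_channel R X S1 S2 Y1 Y2).
Context (c : isac_code R X S1 S2 T1 T2 Y1 Y2 n).

(* Message, local randomness, states, outputs. *)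
Definition sample : finType :=
  (msg c * rnd c * n.-tuple (S1 * S2) * n.-tuple (Y1 * Y2))%type.

Definition message (w : sample) : msg c := w.1.1.1.
Definition randomness (w : sample) : rnd c := w.1.1.2.
Definition states (w : sample) : n.-tuple (S1 * S2) := w.1.2.
Definition outputs (w : sample) : n.-tuple (Y1 * Y2) := w.2.

Definition state1 (w : sample) : n.-tuple S1 := map_tuple fst (states w).
Definition state2 (w : sample) : n.-tuple S2 := map_tuple snd (states w).
Definition output1 (w : sample) : n.-tuple Y1 := map_tuple fst (outputs w).
Definition output2 (w : sample) : n.-tuple Y2 := map_tuple snd (outputs w).

Definition inputs (w : sample) : n.-tuple X :=
  [tuple enc c i (message w) (randomness w) (take i (outputs w)) | i < n].

Definition joint_law (w : sample) : R :=
  (#|msg c|%:R)^-1 * rnd_law c (randomness w) *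
  \prod_(i < n) (state_law ch (tnth (states w) i) *
    output_law ch (tnth (states w) i) (tnth (inputs w) i)
      (tnth (outputs w) i)).

Definition code_rate : R := ln (#|msg c|%:R) / n%:R.

Definition error_prob : R :=
  Pr joint_law [pred w | dec c (output1 w) (state1 w) != message w].

Definition leakage : R := cond_mutual_info joint_law message output2 state2.

Definition avg_distortion (S T : finType) (d : S -> T -> R)
    (s : n.-tuple S) (t : n.-tuple T) : R :=
  (\sum_(i < n) d (tnth s i) (tnth t i)) / n%:R.

Definition distortion1 (d1 : S1 -> T1 -> R) : R :=
  Expect joint_law (fun w =>
    avg_distortion d1 (state1 w) (est1 c (inputs w) (output1 w) (output2 w))).

Definition distortion2 (d2 : S2 -> T2 -> R) : R :=
  Expect joint_law (fun w =>
    avg_distortion d2 (state2 w) (est2 c (inputs w) (output1 w) (output2 w))).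

End Code.

Definition achievable (R : realType) (X S1 S2 T1 T2 Y1 Y2 : finType)
    (ch : isac_channel R X S1 S2 Y1 Y2)
    (d1 : S1 -> T1 -> R) (d2 : S2 -> T2 -> R) (r D1 D2 : R) : Prop :=
  0 <= r /\
  forall delta : R, 0 < delta ->
  exists (n : nat) (c : isac_code R X S1 S2 T1 T2 Y1 Y2 n),
    (0 < n)%N /\
    [/\ r - delta <= code_rate c,
        error_prob ch c <= delta,
        leakage ch c <= delta,
        distortion1 ch c d1 <= D1 + delta
      & distortion2 ch c d2 <= D2 + delta].

Definition region_POF (R : realType) (X S1 S2 T1 T2 Y1 Y2 : finType)
    (ch : isac_channel R X S1 S2 Y1 Y2)
    (d1 : S1 -> T1 -> R) (d2 : S2 -> T2 -> R) : set (R * R * R) :=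
  closure [set t | achievable ch d1 d2 t.1.1 t.1.2 t.2].

Definition hamming (R : realType) (T : finType) (s t : T) : R := (s != t)%:R.
Arguments hamming {R T} s t.

(* The output [None] is the erasure symbol. *)
Definition BEC (R : realType) (gamma : R) (x : bool) (y : option bool) : R :=
  if y is Some b then if b == x then 1 - gamma else 0 else gamma.

Definition BSC (R : realType) (beta : R) (x y : bool) : R :=
  if y == x then 1 - beta else beta.

Definition bec_bsc_state (R : realType) (q alpha : R) (s : bool * bool) : R :=
  match s with
  | (false, false) => 1 - q
  | (true, true) => q * alpha
  | (false, true) => 0
  | (true, false) => q * (1 - alpha)
  end.

(* By the two Markov chains, [Y1] and [Y2] are conditionally independent given
   the input and the states. *)
Definition bec_bsc_output (R : realType) (gamma beta : R) (s : bool * bool)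
    (x : bool) (y : option bool * bool) : R :=
  BEC gamma (s.1 && x) y.1 * BSC beta (s.2 && x) y.2.

Lemma sum_pair (R : realType) (A B : finType) (f : A * B -> R) :
  \sum_t f t = \sum_a \sum_b f (a, b).
Proof.
by rewrite pair_bigA /=; apply: eq_bigr => -[].
Qed.

Lemma sum_option (R : realType) (A : finType) (f : option A -> R) :
  \sum_t f t = f None + \sum_a f (Some a).
Proof.
rewrite (bigD1 None) //=; congr (_ + _).
rewrite (reindex_omap Some id) /=; last by case.
by apply: eq_bigl => a; rewrite eqxx.
Qed.

Lemma bec_bsc_stateP (R : realType) (q alpha : R) :
  0 <= q <= 1 -> 0 <= alpha <= 1 -> is_pmf (bec_bsc_state q alpha).
Proof.
move=> /andP[q0 q1] /andP[a0 a1]; split.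
  by case=> -[] [] /=; rewrite ?mulr_ge0 ?subr_ge0.
by rewrite sum_pair !big_bool /=; ring.
Qed.

Lemma bec_bsc_outputP (R : realType) (gamma beta : R) :
  0 < gamma < 1 -> 0 < beta <= 2^-1 ->
  forall s x, is_pmf (bec_bsc_output gamma beta s x).
Proof.
move=> /andP[g0 g1] /andP[b0 bh] s x.
have b1 : beta <= 1 by apply: (le_trans bh); rewrite invf_le1 ?ler1n.
split.
  move=> [[y1|] y2]; rewrite /bec_bsc_output /BEC /BSC /= mulr_ge0 //;
    by repeat case: ifP => _; rewrite ?subr_ge0 ?(ltW g0) ?(ltW g1) ?(ltW b0).
rewrite sum_pair.
under eq_bigr do rewrite -mulr_sumr /=.
have -> : \sum_(b : bool) BSC beta (s.2 && x) b = 1.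
  by rewrite big_bool /BSC; case: (s.2 && x) => /=;
    rewrite ?subrK // addrC subrK.
under eq_bigr do rewrite mulr1.
rewrite sum_option big_bool /BEC.
by case: (s.1 && x) => /=; rewrite ?addr0 ?add0r addrC subrK.
Qed.

Definition bec_bsc (R : realType) (q alpha gamma beta : R)
    (hq : 0 <= q <= 1) (ha : 0 <= alpha <= 1)
    (hg : 0 < gamma < 1) (hb : 0 < beta <= 2^-1) :
    isac_channel R bool bool bool (option bool) bool :=
  IsacChannel (bec_bsc_stateP hq ha) (bec_bsc_outputP hg hb).

(* Main.v *)
(** Random wiretap coding that ignores the feedback. The codewords [C (m, k)]
    are drawn independently, [m] being the message and [k] the local randomness
    of the encoder. Both error and leakage are controlled by moments of the
    likelihood ratio [W / Q] of channel and output law, for a small exponent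
    [rho > 0]:
    - for maximum-likelihood decoding, a truncated union bound gives an expected
      error of at most [((M - 1) K)^rho * E (Q1 / W1)^rho];
    - the soft-covering argument bounds the expected divergence of the
      eavesdropper's output law given the message from the i.i.d. one by
      [rho^-1 * K^-rho * E (W2 / Q2)^rho].
    For memoryless channels the moments are [n]-th powers, and their logarithms
    are [-rho * I1] and [rho * I2] up to [o(rho)], so that both bounds vanish
    when [log K / n] is slightly above [I2] and [log (M K) / n] slightly below
    [I1]. Chebyshev's inequality takes care of the distortions of the
    letter-by-letter estimators. *)
Require Import Defs.
From mathcomp Require Import all_boot all_order all_algebra.
From mathcomp Require Import all_classical all_reals all_analysis.
From mathcomp Require Import ring lra.
Import Order.TTheory GRing.Theory Num.Theory.
Import numFieldNormedType.Exports.
Local Open Scope classical_set_scope.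
Local Open Scope ring_scope.

Set Implicit Arguments.
Unset Strict Implicit.
Unset Printing Implicit Defensive.

(** * Sums of products over tuples and finite functions *)

Section ProductSums.
Context (R : comNzRingType).

Lemma sum_tuple_prod (n : nat) (T : finType) (F : 'I_n -> T -> R) :
  \sum_(t : n.-tuple T) \prod_i F i (tnth t i) = \prod_i \sum_x F i x.
Proof.
rewrite bigA_distr_bigA /= (reindex (@tuple_of_finfun T n)) /=; last first.
  by exists (@finfun_of_tuple T n) => f _; rewrite ?tuple_of_finfunK ?finfun_of_tupleK.
by apply: eq_bigr => f _; apply: eq_bigr => i _; rewrite tnth_mktuple.
Qed.

Lemma sum_tuple2_prod (n : nat) (S Y : finType) (F : 'I_n -> S * Y -> R) :
  \sum_(t : n.-tuple S * n.-tuple Y) \prod_i F i (tnth t.1 i, tnth t.2 i) =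
  \prod_i \sum_z F i z.
Proof.
transitivity (\sum_(s : n.-tuple S) \sum_(y : n.-tuple Y)
    \prod_i F i (tnth s i, tnth y i)).
  by rewrite pair_bigA.
under [LHS]eq_bigr => s _ do rewrite (sum_tuple_prod (fun i y => F i (tnth s i, y))).
rewrite (sum_tuple_prod (fun i s => \sum_y F i (s, y))).
by apply: eq_bigr => i _; rewrite pair_bigA /=; apply: eq_bigr => -[].
Qed.

Lemma prod_natb (I : finType) (p : pred I) (F : I -> R) :
  \prod_i (F i * (p i)%:R) = (\prod_i F i) * [forall i, p i]%:R.
Proof.
case: (boolP [forall i, p i]) => [/forallP h|/forallPn[i /negbTE h]].
  by rewrite mulr1; apply: eq_bigr => i _; rewrite h mulr1.
by rewrite mulr0 (bigD1 i) //= h mulr0 mul0r.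
Qed.

Lemma map_tuple_eqE (n : nat) (T : Type) (T' : eqType) (f : T -> T')
    (t : n.-tuple T) (t' : n.-tuple T') :
  (map_tuple f t == t') = [forall i, f (tnth t i) == tnth t' i].
Proof.
apply/eqP/forallP => [<- i|h]; first by rewrite tnth_map.
by apply: eq_from_tnth => i; rewrite tnth_map; apply/eqP/h.
Qed.

(** The indicator of the event is a product of letterwise indicators, so the constrained sum still
    factors over the coordinates. *)
Lemma marginal_tuple2_prod (n : nat) (S Y S' Y' : finType)
    (f : S -> S') (g : Y -> Y') (F : 'I_n -> S * Y -> R)
    (s' : n.-tuple S') (y' : n.-tuple Y') :
  \sum_(t : n.-tuple S * n.-tuple Y |
      (map_tuple f t.1 == s') && (map_tuple g t.2 == y'))
    \prod_i F i (tnth t.1 i, tnth t.2 i) =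
  \prod_i \sum_(z | (f z.1 == tnth s' i) && (g z.2 == tnth y' i)) F i z.
Proof.
under [RHS]eq_bigr => i _ do rewrite big_mkcond /=.
rewrite -(sum_tuple2_prod (fun i z =>
  if (f z.1 == tnth s' i) && (g z.2 == tnth y' i) then F i z else 0)).
rewrite big_mkcond; apply: eq_bigr => -[s y] _ /=.
transitivity (\prod_i (F i (tnth s i, tnth y i) *
    ((f (tnth s i) == tnth s' i) && (g (tnth y i) == tnth y' i))%:R)).
  rewrite prod_natb !map_tuple_eqE.
  have -> : [forall i, (f (tnth s i) == tnth s' i) && (g (tnth y i) == tnth y' i)]
      = [forall i, f (tnth s i) == tnth s' i] && [forall i, g (tnth y i) == tnth y' i].
    apply/forallP/andP => [h|[/forallP h1 /forallP h2] i]; last by rewrite h1 h2.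
    by split; apply/forallP => i; case/andP: (h i).
  by case: ifP => _; rewrite ?mulr1 ?mulr0.
by apply: eq_bigr => i _; case: ifP => _; rewrite ?mulr1 ?mulr0.
Qed.

Lemma expect_tuple2_coord (n : nat) (S Y : finType) (F : 'I_n -> S * Y -> R)
    (g : S -> Y -> R) (i : 'I_n) :
  (forall j, \sum_z F j z = 1) ->
  \sum_(t : n.-tuple S * n.-tuple Y)
    (\prod_j F j (tnth t.1 j, tnth t.2 j)) * g (tnth t.1 i) (tnth t.2 i) =
  \sum_z F i z * g z.1 z.2.
Proof.
move=> F1.
transitivity (\prod_j \sum_z F j z * (if j == i then g z.1 z.2 else 1)).
  rewrite -(sum_tuple2_prod (fun j z => F j z * (if j == i then g z.1 z.2 else 1))).
  apply: eq_bigr => t _; rewrite big_split /=; congr (_ * _).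
  by rewrite (bigD1 i) //= eqxx big1 ?mulr1 // => j /negbTE ->.
rewrite (bigD1 i) //= eqxx [X in _ * X]big1 ?mulr1 // => j /negbTE ->.
by under eq_bigr do rewrite mulr1; exact: F1.
Qed.

Lemma expect_ffun_coord (I T : finType) (P : T -> R) (g : T -> R) (i : I) :
  \sum_x P x = 1 ->
  \sum_(f : {ffun I -> T}) (\prod_j P (f j)) * g (f i) = \sum_x P x * g x.
Proof.
move=> P1.
transitivity (\prod_(j : I) \sum_x P x * (if j == i then g x else 1)).
  rewrite bigA_distr_bigA; apply: eq_bigr => f _; rewrite big_split /=.
  by congr (_ * _); rewrite (bigD1 i) //= eqxx big1 ?mulr1 // => j /negbTE ->.
rewrite (bigD1 i) //= eqxx [X in _ * X]big1 ?mulr1 // => j /negbTE ->.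
by under eq_bigr do rewrite mulr1; exact: P1.
Qed.

Lemma expect_ffun_coord2 (I T : finType) (P : T -> R) (g : T -> T -> R) (i k : I) :
  \sum_x P x = 1 -> i != k ->
  \sum_(f : {ffun I -> T}) (\prod_j P (f j)) * g (f i) (f k) =
  \sum_x \sum_y P x * P y * g x y.
Proof.
move=> P1 ik.
have ki : (k == i) = false by rewrite eq_sym; apply/negbTE.
(* Splitting on the value [x] of [f i] turns [g (f i) (f k)] into a product of one-coordinate
   factors, to which distributivity applies. *)
transitivity (\sum_x \sum_(f : {ffun I -> T})
    (\prod_j P (f j)) * ((f i == x)%:R * g x (f k))).
  rewrite exchange_big; apply: eq_bigr => f _; rewrite -mulr_sumr; congr (_ * _).
  rewrite (bigD1 (f i)) //= eqxx mul1r big1 ?addr0 // => x.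
  by rewrite eq_sym => /negbTE ->; rewrite mul0r.
apply: eq_bigr => x _.
transitivity (\prod_(j : I) \sum_z P z *
    (if j == i then (z == x)%:R else if j == k then g x z else 1)).
  rewrite bigA_distr_bigA; apply: eq_bigr => f _; rewrite big_split /=.
  congr (_ * _); rewrite (bigD1 i) //= eqxx (bigD1 k) /=; last by rewrite ki.
  rewrite ki eqxx big1 ?mulr1 // => j /andP[/negbTE -> /negbTE ->] //.
rewrite (bigD1 i) //= (bigD1 k) /=; last by rewrite ki.
rewrite ki !eqxx [X in _ * (_ * X)]big1 ?mulr1; last first.
  by move=> j /andP[/negbTE -> /negbTE ->]; under eq_bigr do rewrite mulr1.
rewrite (bigD1 x) //= eqxx mulr1 [X in _ + X]big1 ?addr0 ?mulr_sumr.
  by apply: eq_bigr => y _; rewrite mulrA.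
by move=> z /negbTE ->; rewrite mulr0.
Qed.

End ProductSums.

(** * Logarithmic and exponential inequalities *)

Section Analytic.
Context (R : realType).

Lemma ln_le_sub1 (x : R) : 0 < x -> ln x <= x - 1.
Proof.
move=> x0; have := @le_ln1Dx R (x - 1).
by rewrite addrCA subrr addr0; apply; lra.
Qed.

(** This is [ln (q / p) <= q / p - 1] multiplied by [p]. Absolute continuity is essential: for
    [q = 0 < p] the totalized right-hand side is [0]. *)
Lemma sub_le_mul_ln_div (p q : R) : 0 <= p -> 0 <= q -> (q = 0 -> p = 0) ->
  p - q <= p * ln (p / q).
Proof.
move=> p0 q0 qp; have [->|pn0] := eqVneq p 0; first by rewrite mul0r; lra.
have {}p0 : 0 < p by rewrite lt_neqAle eq_sym pn0.
have {}q0 : 0 < q.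
  by rewrite lt_neqAle q0 andbT eq_sym; apply: contra_neq pn0.
have -> : p / q = (q / p)^-1 by rewrite invf_div.
rewrite lnV ?posrE ?divr_gt0 // mulrN.
have := ln_le_sub1 (divr_gt0 q0 p0).
rewrite -(ler_pM2l p0) mulrBr mulr1 mulrCA divff ?mulr1; lra.
Qed.

Lemma divergence_ge0 (T : finType) (p q : T -> R) :
  (forall t, 0 <= p t) -> (forall t, 0 <= q t) -> \sum_t q t <= \sum_t p t ->
  (forall t, q t = 0 -> p t = 0) -> 0 <= \sum_t p t * ln (p t / q t).
Proof.
move=> p0 q0 qp ac; apply: (@le_trans _ _ (\sum_t (p t - q t))).
  by rewrite sumrB subr_ge0.
by apply: ler_sum => t _; apply: sub_le_mul_ln_div => //; apply: ac.
Qed.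

(** For [x <= 1], [ln (1 + x) <= x <= x ^ rho]. For [x > 1], [ln (1 + x) = ln x + ln (1 + 1 / x)],
    where the first term is at most [(x ^ rho - 1) / rho] and the second at most [1 <= 1 / rho]. *)
Lemma ln1D_le_powR (x rho : R) : 0 <= x -> 0 < rho <= 1 ->
  ln (1 + x) <= rho^-1 * x `^ rho.
Proof.
move=> x0 /andP[r0 r1].
have ri1 : 1 <= rho^-1 by rewrite invf_ge1.
have [x1|x1] := leP x 1.
  have [->|xn0] := eqVneq x 0.
    by rewrite addr0 ln1 mulr_ge0 ?powR_ge0 // invr_ge0 ltW.
  have {}x0 : 0 < x by rewrite lt_neqAle eq_sym xn0.
  apply: (@le_trans _ _ x); first by apply: le_ln1Dx; lra.
  apply: (@le_trans _ _ (x `^ rho)); first by apply: ger1_powR => //; rewrite x0.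
  by rewrite ler_peMl ?powR_ge0.
have {}x0 : 0 < x by lra.
have -> : 1 + x = x * (1 + x^-1) by rewrite mulrDr mulr1 divff ?gt_eqF // addrC.
have xi0 : 0 < x^-1 by rewrite invr_gt0.
have xi1 : x^-1 <= 1 by rewrite invf_le1 // ltW.
rewrite lnM ?posrE //; last lra.
have h1 : ln (1 + x^-1) <= x^-1 by apply: le_ln1Dx; lra.
have h2 : ln x = rho^-1 * ln (x `^ rho).
  by rewrite ln_powR mulrA mulVf ?mul1r // gt_eqF.
have h3 : rho^-1 * ln (x `^ rho) <= rho^-1 * (x `^ rho - 1).
  by apply: ler_wpM2l; [rewrite invr_ge0 ltW|rewrite ln_le_sub1 ?powR_gt0].
rewrite h2; lra.
Qed.

(** From [exp (- x) >= 1 - x] and [(1 + x + 2 x^2) (1 - x) = 1 + x^2 (1 - 2 x) >= 1]. *)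
Lemma expR_le_quad (x : R) : `|x| <= 2^-1 -> expR x <= 1 + x + 2 * x ^+ 2.
Proof.
rewrite ler_norml => /andP[x1 x2].
have e1 := @expR_ge1Dx R (- x).
rewrite -[expR x]invrK -expRN -[leRHS]invrK lef_pV2 ?posrE ?expR_gt0 //; last first.
  by rewrite invr_gt0; nra.
apply: le_trans e1.
rewrite -div1r ler_pdivrMr; nra.
Qed.

(** First-order expansion of a log-moment generating function at [0]: the quadratic remainder is
    absorbed in [rho * e] once [rho] is small. *)
Lemma exp_moment_le (J : finType) (p l : J -> R) (e : R) :
  is_pmf p -> 0 < e -> exists2 rho0 : R, 0 < rho0 &
  forall rho, 0 < rho <= rho0 ->
    \sum_j p j * expR (rho * l j) <= expR (rho * (\sum_j p j * l j + e)).
Proof.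
move=> [p0 p1] e0.
pose L := 1 + \sum_j `|l j|.
have L1 : 1 <= L by rewrite lerDl sumr_ge0.
have lL j : `|l j| <= L.
  rewrite /L (bigD1 j) //= addrCA lerDl addr_ge0 // sumr_ge0 //.
(* The first bound gives [|rho * l j| <= 1 / 2], as [expR_le_quad] requires; the second gives
   [2 (rho * l j)^2 <= rho * e]. *)
exists (Num.min ((2 * L)^-1) (e / (2 * L ^+ 2))).
  by rewrite lt_min invr_gt0 divr_gt0 //; nra.
move=> rho /andP[r0]; rewrite le_min => /andP[].
rewrite -div1r !ler_pdivlMr; [|nra|nra] => h1 h2.
apply: le_trans (expR_ge1Dx _).
apply: (@le_trans _ _ (\sum_j (p j * (1 + rho * e) + rho * (p j * l j)))).
  apply: ler_sum => j _.
  have -> : p j * (1 + rho * e) + rho * (p j * l j) = p j * (1 + rho * l j + rho * e).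
    by ring.
  apply: ler_wpM2l => //.
  apply: (le_trans (@expR_le_quad _ _)).
    rewrite normrM gtr0_norm // -div1r ler_pdivlMr //; have := lL j; nra.
  rewrite lerD2l exprMn.
  have := lL j; rewrite ler_norml => /andP[lL1 lL2].
  have lL3 : l j ^+ 2 <= L ^+ 2 by rewrite -subr_ge0 subr_sqr mulr_ge0 //; lra.
  have : rho ^+ 2 * l j ^+ 2 <= rho ^+ 2 * L ^+ 2 by rewrite ler_wpM2l ?sqr_ge0.
  rewrite !expr2 in h2 *; nra.
rewrite big_split /= -mulr_suml p1 -mulr_sumr; lra.
Qed.

End Analytic.

(** * Random codebooks *)

Lemma sumr_constE (R : nzRingType) (I : finType) (p : pred I) (x : R) :
  \sum_(i | p i) x = #|p|%:R * x.
Proof. by rewrite sumr_const mulr_natl. Qed.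

Section RandomCodebook.
Context (R : realType) (A B msg rnd : finType).
Variables (P : A -> R) (V : A -> B -> R).
Hypothesis P_pmf : is_pmf P.
Hypothesis V_ge0 : forall a b, 0 <= V a b.

Definition output_dist (b : B) : R := \sum_a P a * V a b.

Local Notation Q := output_dist.
Local Notation codebook := {ffun msg * rnd -> A}.

Definition codebook_law (C : codebook) : R := \prod_u P (C u).

(** The likelihood is maximized over message and randomness jointly, and only the message is kept;
    [u0] witnesses that the index set is inhabited. *)
Definition ml_decode (u0 : msg * rnd) (C : codebook) (b : B) : msg :=
  ([arg max_(u > u0) V (C u) b]%O).1.

Definition codebook_error (u0 : msg * rnd) (C : codebook) : R :=
  \sum_u \sum_b #|{: msg * rnd}|%:R^-1 *
    (V (C u) b * (ml_decode u0 C b != u.1)%:R).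

Definition msg_output_dist (C : codebook) (m : msg) (b : B) : R :=
  #|rnd|%:R^-1 * \sum_k V (C (m, k)) b.

Definition codebook_divergence (C : codebook) : R :=
  \sum_m #|msg|%:R^-1 *
    \sum_b msg_output_dist C m b * ln (msg_output_dist C m b / Q b).

Lemma output_dist_ge0 b : 0 <= Q b.
Proof. by apply: sumr_ge0 => a _; rewrite mulr_ge0 //; case: P_pmf. Qed.

Lemma codebook_law_ge0 C : 0 <= codebook_law C.
Proof. by apply: prodr_ge0 => u _; case: P_pmf. Qed.

Lemma codebook_law_sum1 : \sum_C codebook_law C = 1.
Proof.
rewrite /codebook_law -(bigA_distr_bigA (fun (u : msg * rnd) a => P a)).
by rewrite big1 // => u _; case: P_pmf.
Qed.

(** A codebook of positive probability uses only codewords in the support of [P]. This gives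
    absolute continuity with respect to [Q], so that the totalized quotients by [Q b] are
    genuine. *)
Lemma output_dist_gt0 C u b : 0 < codebook_law C -> 0 < V (C u) b -> 0 < Q b.
Proof.
move=> C0 Vb; case: P_pmf => P0 _.
have Pu : 0 < P (C u).
  rewrite lt_neqAle P0 andbT eq_sym; apply: contraTneq C0 => Pu0.
  by rewrite /codebook_law (bigD1 u) //= Pu0 mul0r ltxx.
apply: (@lt_le_trans _ _ (P (C u) * V (C u) b)); first exact: mulr_gt0.
by rewrite /Q (bigD1 (C u)) //= lerDl sumr_ge0 // => a _; rewrite mulr_ge0.
Qed.

(** The left-hand side is [min 1 t], written with indicators as it arises from the union bound. *)
Lemma truncated_le_powR (t rho : R) : 0 <= t -> 0 < rho <= 1 ->
  (1 <= t)%R%:R + (t < 1)%R%:R * t <= t `^ rho.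
Proof.
move=> t0 /andP[r0 r1]; have [t1|t1] := leP 1 t.
  by rewrite mul0r addr0 -[leLHS](powRr0 t); apply: ler_powR => //; exact: ltW.
rewrite mul1r add0r; have [->|tn0] := eqVneq t 0; first exact: powR_ge0.
by apply: ger1_powR => //; rewrite lt_neqAle eq_sym tn0 t0 ltW.
Qed.

(* Union bound, truncated at [1] at a threshold depending only on the
   transmitted codeword, so that no conditional Jensen inequality is needed;
   for a random codeword [A'], [P (V a b <= V A' b) <= Q b / V a b] by Markov's
   inequality. *)
Lemma expect_letter_error u0 (rho : R) (u : msg * rnd) (b : B) :
  0 < rho <= 1 ->
  \sum_C codebook_law C * (V (C u) b * (ml_decode u0 C b != u.1)%:R) <=
  (#|msg|.-1 * #|rnd|)%:R `^ rho *
    \sum_a P a * (V a b * (Q b / V a b) `^ rho).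
Proof.
move=> hrho; case: P_pmf => P0 P1.
(* Only pairs carrying another message are wrong, since confusing [k] alone is no error; [N] counts
   them. By Markov's inequality [t a] bounds the expected number of wrong codewords at least as
   likely as [a]. *)
pose N : R := (#|msg|.-1 * #|rnd|)%:R.
pose t a := N * (Q b / V a b).
have t0 a : 0 <= t a by rewrite !mulr_ge0 ?invr_ge0 ?output_dist_ge0.
pose wrong := [pred v : msg * rnd | v.1 != u.1].
have card_wrong : #|wrong|%:R = N.
  congr (_%:R); have -> : #|wrong| = #|predX (predC1 u.1) (@predT rnd)|.
    by apply: eq_card => -[m k]; rewrite !inE andbT.
  by rewrite cardX cardC1.
(* An error requires a wrong pair [v] whose likelihood reaches that of [u], ties included. Where
   [t (C u) >= 1] the error indicator is bounded by [1] instead. *)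
have ub (C : codebook) : V (C u) b * (ml_decode u0 C b != u.1)%:R <=
    V (C u) b * (1 <= t (C u))%R%:R + \sum_(v | wrong v)
      V (C u) b * ((t (C u) < 1)%R%:R * (V (C u) b <= V (C v) b)%R%:R).
  rewrite -mulr_sumr -mulrDr ler_wpM2l //.
  have sum0 : 0 <= \sum_(v | wrong v) (t (C u) < 1)%R%:R *
      (V (C u) b <= V (C v) b)%R%:R :> R.
    by apply: sumr_ge0 => v _; rewrite mulr_ge0.
  move: sum0; case: leP => tC sum0; first by case: (_ != _) => /=; lra.
  rewrite add0r; rewrite /ml_decode; case: arg_maxP => //= v _ vmax.
  case: (boolP (v.1 != u.1)) => [vu|_].
    rewrite (bigD1 v) //= mul1r vmax // lerDl.
    by apply: sumr_ge0 => w _; rewrite mulr_ge0.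
  by apply: sumr_ge0 => w _; rewrite mulr_ge0.
apply: (@le_trans _ _ (\sum_C codebook_law C * (V (C u) b * (1 <= t (C u))%R%:R +
    \sum_(v | wrong v)
      V (C u) b * ((t (C u) < 1)%R%:R * (V (C u) b <= V (C v) b)%R%:R)))).
  by apply: ler_sum => C _; rewrite ler_wpM2l ?codebook_law_ge0 ?ub.
under eq_bigr do rewrite mulrDr mulr_sumr.
rewrite big_split /= exchange_big /=.
rewrite (expect_ffun_coord (fun a => V a b * (1 <= t a)%R%:R)) //.
under [X in _ + X]eq_bigr => v /= vu.
  rewrite (expect_ffun_coord2 (fun a a' => V a b * ((t a < 1)%R%:R * (V a b <= V a' b)%R%:R))) //.
    over.
  by apply: contraNneq vu => ->.
rewrite /= [X in _ + X]sumr_constE (_ : #|_|%:R = N); last first.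
  by rewrite -card_wrong; congr (_%:R); exact: eq_card.
rewrite [N * _]mulr_sumr -big_split /=.
rewrite mulr_sumr; apply: ler_sum => a _.
have -> : \sum_y P a * P y * (V a b * ((t a < 1)%R%:R * (V a b <= V y b)%R%:R)) =
   P a * (V a b * ((t a < 1)%R%:R * \sum_y P y * (V a b <= V y b)%R%:R)).
  rewrite !mulr_sumr; apply: eq_bigr => y _; ring.
rewrite [leRHS]mulrCA [N * _]mulrCA -mulrDr ler_wpM2l //.
rewrite [leRHS]mulrCA [N * _]mulrCA -mulrDr.
have [->|Vn0] := eqVneq (V a b) 0; first by rewrite !mul0r.
have Va : 0 < V a b by rewrite lt_neqAle eq_sym Vn0 V_ge0.
rewrite ler_wpM2l // -powRM ?divr_ge0 ?output_dist_ge0 // -/(t a).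
apply: le_trans (truncated_le_powR (t0 a) hrho).
rewrite lerD2l [N * _]mulrCA ler_wpM2l // ler_wpM2l //.
rewrite ler_pdivlMr // mulr_suml; apply: ler_sum => y _.
rewrite -mulrA ler_wpM2l //; case: (leP (V a b) (V y b)) => [|_]; first by rewrite /= mul1r.
by rewrite /= mul0r.
Qed.

Lemma expect_codebook_error u0 (rho : R) : 0 < rho <= 1 ->
  \sum_C codebook_law C * codebook_error u0 C <=
  (#|msg|.-1 * #|rnd|)%:R `^ rho *
    \sum_a \sum_b P a * (V a b * (Q b / V a b) `^ rho).
Proof.
move=> hrho; under eq_bigr do rewrite mulr_sumr.
rewrite exchange_big /=.
apply: (@le_trans _ _ (\sum_(u : msg * rnd) #|{: msg * rnd}|%:R^-1 *
   ((#|msg|.-1 * #|rnd|)%:R `^ rho *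
    \sum_a \sum_b P a * (V a b * (Q b / V a b) `^ rho)))); last first.
  rewrite sumr_constE mulrA divff ?mul1r // pnatr_eq0 -lt0n.
  by apply/card_gt0P; exists u0.
apply: ler_sum => u _; under eq_bigr do rewrite mulr_sumr.
rewrite exchange_big [X in _ * (_ * X)]exchange_big /= !mulr_sumr.
apply: ler_sum => b _.
under eq_bigr do rewrite mulrCA.
by rewrite -mulr_sumr ler_wpM2l ?invr_ge0 // expect_letter_error.
Qed.

(* Jensen's inequality for [ln], through its tangent at the conditional mean
   [z0] of [msg_output_dist C m b / Q b] given the codeword [C (m, k)]. *)
Lemma expect_letter_divergence (m : msg) (k : rnd) (b : B) :
  \sum_C codebook_law C *
    (V (C (m, k)) b * ln (msg_output_dist C m b / Q b)) <=
  \sum_a P a * (V a b * ln (1 + V a b / (#|rnd|%:R * Q b))).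
Proof.
case: P_pmf => P0 P1.
pose K : R := #|rnd|%:R.
have K1 : 1 <= K by rewrite ler1n; apply/card_gt0P; exists k.
have K0 : 0 < K by lra.
pose z0 a := 1 + V a b / (K * Q b).
have z0_ge1 a : 1 <= z0 a.
  by rewrite lerDl divr_ge0 // mulr_ge0 ?output_dist_ge0 // ltW.
have z0_gt0 a : 0 < z0 a by apply: lt_le_trans (z0_ge1 a).
(* The tangent bound is [ln z <= ln z0 + z / z0 - 1]. Here [z] is [z0 - 1] plus the contributions of
   the other [k'], so that [z / z0 - 1] becomes [- 1 / z0] plus those contributions divided by
   [z0]. *)
have ub (C : codebook) :
    codebook_law C * (V (C (m, k)) b * ln (msg_output_dist C m b / Q b)) <=
    codebook_law C * (V (C (m, k)) b *
      (ln (z0 (C (m, k))) - (z0 (C (m, k)))^-1) +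
      \sum_(k' | k' != k) V (C (m, k)) b / z0 (C (m, k)) *
          (V (C (m, k')) b / (K * Q b))).
  have [C0|Cn0] := eqVneq (codebook_law C) 0; first by rewrite C0 !mul0r.
  have CC : 0 < codebook_law C by rewrite lt_neqAle eq_sym Cn0 codebook_law_ge0.
  rewrite ler_wpM2l ?codebook_law_ge0 // -mulr_sumr -mulrA -mulrDr.
  have [->|Vn0] := eqVneq (V (C (m, k)) b) 0; first by rewrite !mul0r.
  have Va : 0 < V (C (m, k)) b by rewrite lt_neqAle eq_sym Vn0 V_ge0.
  have Qb := output_dist_gt0 CC Va.
  rewrite ler_wpM2l //.
  have -> : msg_output_dist C m b / Q b =
      z0 (C (m, k)) - 1 + \sum_(k' | k' != k) V (C (m, k')) b / (K * Q b).
    rewrite /msg_output_dist (bigD1 k) //= /z0 -mulr_suml -/K.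
    by field; rewrite !gt_eqF.
  set s := \sum_(k' | _) _; set z := z0 _.
  have s0 : 0 <= s.
    apply: sumr_ge0 => k' _; rewrite divr_ge0 ?mulr_ge0 ?output_dist_ge0 ?(ltW K0) //.
  have zgt : 0 < z - 1 by rewrite /z /z0 addrAC subrr add0r divr_gt0 // mulr_gt0.
  have zp : 0 < z by lra.
  have sp : 0 < z - 1 + s by lra.
  have := ln_le_sub1 (divr_gt0 sp zp); rewrite ln_div ?posrE // => h.
  have -> : ln z - z^-1 + z^-1 * s = ln z + ((z - 1 + s) / z - 1).
    by field; rewrite gt_eqF.
  lra.
apply: (le_trans (ler_sum _ (fun C _ => ub C))).
under eq_bigr do rewrite mulrDr mulr_sumr.
rewrite big_split /= exchange_big /=.
rewrite (expect_ffun_coord (fun a => V a b * (ln (z0 a) - (z0 a)^-1))) //.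
under [X in _ + X]eq_bigr => k' /= kk'.
  rewrite (expect_ffun_coord2 (fun a a' => V a b / z0 a * (V a' b / (K * Q b)))) //.
    over.
  by apply: contraNneq kk' => -[->].
rewrite sumr_constE mulr_sumr -big_split /=; apply: ler_sum => a _.
have -> : \sum_y P a * P y * (V a b / z0 a * (V y b / (K * Q b))) =
   P a * (V a b * ((z0 a)^-1 * (K^-1 * (Q b / Q b)))).
  transitivity (\sum_y P a * (V a b / z0 a) / (K * Q b) * (P y * V y b)).
    by apply: eq_bigr => y _; ring.
  by rewrite -mulr_sumr -/(Q b) invfM; ring.
rewrite [X in _ + X]mulrCA -mulrDr ler_wpM2l //.
rewrite [X in _ + X]mulrCA -mulrDr ler_wpM2l // -/K -/(z0 a).
(* The [K - 1] other codewords contribute on average at most [(K - 1) / K <= 1] before division by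
   [z0 a], which the term [- 1 / z0 a] compensates. *)
suff : #|(fun k' => k' != k)|%:R * ((z0 a)^-1 * (K^-1 * (Q b / Q b))) <= (z0 a)^-1.
  by lra.
rewrite mulrCA -[leRHS]mulr1 ler_wpM2l ?invr_ge0 ?(ltW (z0_gt0 _)) //.
rewrite mulrA mulr_ile1 ?divr_ge0 ?output_dist_ge0 ?(ltW K0) //.
  by rewrite ler_pdivrMr // mul1r ler_nat max_card.
by have [->|Qn0] := eqVneq (Q b) 0; rewrite ?mul0r ?divff.
Qed.

(** The letter bound is averaged over message and randomness; [ln1D_le_powR] at [V a b / (K * Q b)]
    then releases the factor [K ^ (- rho)]. *)
Lemma expect_codebook_divergence (rho : R) (m0 : msg) (k0 : rnd) :
  0 < rho <= 1 ->
  \sum_C codebook_law C * codebook_divergence C <=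
  rho^-1 * #|rnd|%:R `^ (- rho) *
    \sum_a \sum_b P a * (V a b * (V a b / Q b) `^ rho).
Proof.
move=> hrho; case: P_pmf => P0 P1.
have K0 : (0 : R) < #|rnd|%:R by rewrite ltr0n; apply/card_gt0P; exists k0.
have M0 : (0 : R) < #|msg|%:R by rewrite ltr0n; apply/card_gt0P; exists m0.
set T := leRHS.
under eq_bigr do rewrite mulr_sumr.
rewrite exchange_big /=.
apply: (@le_trans _ _ (\sum_(m : msg) #|msg|%:R^-1 * T)); last first.
  by rewrite sumr_constE mulrA divff ?mul1r // gt_eqF.
apply: ler_sum => m _; under eq_bigr do rewrite mulrCA.
rewrite -mulr_sumr ler_wpM2l ?invr_ge0 ?(ltW M0) //.
under eq_bigr do rewrite mulr_sumr.
rewrite exchange_big /= /T [X in _ * X]exchange_big /= mulr_sumr.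
apply: ler_sum => b _.
apply: (@le_trans _ _ (\sum_(k : rnd) #|rnd|%:R^-1 *
   \sum_a P a * (V a b * ln (1 + V a b / (#|rnd|%:R * Q b))))).
  have E C : codebook_law C * (msg_output_dist C m b *
      ln (msg_output_dist C m b / Q b)) =
      \sum_k #|rnd|%:R^-1 * (codebook_law C *
        (V (C (m, k)) b * ln (msg_output_dist C m b / Q b))).
    rewrite {1}/msg_output_dist mulr_sumr mulr_suml mulr_sumr.
    by apply: eq_bigr => k _; ring.
  under eq_bigr do rewrite E.
  rewrite exchange_big /=; apply: ler_sum => k _; rewrite -mulr_sumr.
  by rewrite ler_wpM2l ?invr_ge0 ?(ltW K0) // expect_letter_divergence.
rewrite sumr_constE mulVKf ?gt_eqF //.
rewrite [leRHS]mulr_sumr; apply: ler_sum => a _.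
rewrite [leRHS]mulrCA ler_wpM2l // [leRHS]mulrCA ler_wpM2l //.
apply: le_trans (ln1D_le_powR _ hrho) _.
  by rewrite divr_ge0 // mulr_ge0 ?output_dist_ge0 // ltW.
rewrite -mulrA ler_wpM2l ?invr_ge0 //; first by case/andP: hrho => /ltW.
rewrite invfM mulrCA [leLHS]powRM ?invr_ge0 ?(ltW K0) ?divr_ge0 ?output_dist_ge0 //.
by rewrite -[_%:R^-1]powR_inv1 ?(ltW K0) // -powRrM mulN1r.
Qed.

End RandomCodebook.

(** * Existence of a codebook meeting all requirements at once *)

Section ExistsCodebook.
Context (R : realType) (A B1 B2 msg rnd : finType).
Variables (P : A -> R) (V1 : A -> B1 -> R) (V2 : A -> B2 -> R) (cost : A -> R).
Hypothesis P_pmf : is_pmf P.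
Hypothesis V1_pmf : forall a, is_pmf (V1 a).
Hypothesis V2_pmf : forall a, is_pmf (V2 a).
Hypothesis cost_ge0 : forall a, 0 <= cost a.

Lemma output_dist_pmf : is_pmf (output_dist P V2).
Proof.
case: (P_pmf) => P0 P1; split.
  by move=> b; apply: output_dist_ge0 => // a b'; case: (V2_pmf a).
rewrite /output_dist exchange_big /= -P1; apply: eq_bigr => a _.
by rewrite -mulr_sumr; case: (V2_pmf a) => _ ->; rewrite mulr1.
Qed.

Lemma msg_output_dist_pmf (C : {ffun msg * rnd -> A}) (m : msg) (k0 : rnd) :
  is_pmf (msg_output_dist V2 C m).
Proof.
have K0 : (0 : R) < #|rnd|%:R by rewrite ltr0n; apply/card_gt0P; exists k0.
split.
  move=> b; rewrite mulr_ge0 ?invr_ge0 ?(ltW K0) // sumr_ge0 // => k _.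
  by case: (V2_pmf (C (m, k))).
rewrite -mulr_sumr exchange_big /=.
under eq_bigr do rewrite (V2_pmf _).2.
by rewrite sumr_constE mulr1 mulVf // gt_eqF.
Qed.

Lemma msg_output_dist_ac (C : {ffun msg * rnd -> A}) (m : msg) (b : B2) :
  0 < codebook_law P C -> output_dist P V2 b = 0 -> msg_output_dist V2 C m b = 0.
Proof.
move=> C0 Qb; rewrite /msg_output_dist big1 ?mulr0 // => k _.
have V0 a b' : 0 <= V2 a b' by case: (V2_pmf a).
apply/eqP; rewrite eq_le V0 andbT leNgt; apply/negP => Vb.
by have := output_dist_gt0 P_pmf V0 C0 Vb; rewrite Qb ltxx.
Qed.

Lemma codebook_divergence_ge0 (C : {ffun msg * rnd -> A}) (k0 : rnd) :
  0 < codebook_law P C -> 0 <= codebook_divergence P V2 C.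
Proof.
move=> C0; apply: sumr_ge0 => m _; rewrite mulr_ge0 ?invr_ge0 //.
have [p0 p1] := msg_output_dist_pmf C m k0.
have [q0 q1] := output_dist_pmf.
apply: divergence_ge0 => //; first by rewrite p1 q1.
by move=> b; exact: msg_output_dist_ac.
Qed.

(** First-moment method on the sum of error, divergence and cost. On codebooks of positive
    probability all three are nonnegative, so a total below [d] bounds each of them. *)
Lemma exists_codebook (u0 : msg * rnd) (rho d : R) : 0 < rho <= 1 ->
  (#|msg|.-1 * #|rnd|)%:R `^ rho *
    (\sum_a \sum_b P a * (V1 a b * (output_dist P V1 b / V1 a b) `^ rho)) +
  rho^-1 * #|rnd|%:R `^ (- rho) *
    (\sum_a \sum_b P a * (V2 a b * (V2 a b / output_dist P V2 b) `^ rho)) +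
  \sum_a P a * cost a < d ->
  exists C : {ffun msg * rnd -> A},
    [/\ 0 < codebook_law P C, codebook_error V1 u0 C <= d,
        codebook_divergence P V2 C <= d
      & #|{: msg * rnd}|%:R^-1 * (\sum_u cost (C u)) <= d].
Proof.
move=> hrho hd; case: (P_pmf) => P0 P1.
have V10 a b : 0 <= V1 a b by case: (V1_pmf a).
have V20 a b : 0 <= V2 a b by case: (V2_pmf a).
have U0 : (0 : R) < #|{: msg * rnd}|%:R by rewrite ltr0n; apply/card_gt0P; exists u0.
pose total C := codebook_error V1 u0 C + codebook_divergence P V2 C +
  #|{: msg * rnd}|%:R^-1 * (\sum_u cost (C u)).
have total_lt : \sum_C codebook_law P C * total C < d.
  apply: le_lt_trans hd; rewrite /total.
  under eq_bigr do rewrite !mulrDr.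
  rewrite !big_split /= lerD ?lerD //.
  - exact: expect_codebook_error.
  - exact: (expect_codebook_divergence P_pmf V20 u0.1 u0.2).
  - under eq_bigr do rewrite mulrCA mulr_sumr.
    rewrite -mulr_sumr exchange_big /=.
    under eq_bigr do rewrite (expect_ffun_coord cost _ P1).
    by rewrite sumr_constE mulKf ?gt_eqF.
(* The strict comparison of weighted values also excludes codebooks of probability zero, on which
   absolute continuity could fail. *)
have [C hC] : exists C, codebook_law P C * total C < codebook_law P C * d.
  apply/not_existsP => h; move: total_lt; apply/negP; rewrite -leNgt.
  rewrite -[d]mul1r -(codebook_law_sum1 msg rnd P_pmf) mulr_suml.
  by apply: ler_sum => C _; rewrite leNgt; apply/negP/h.
have C0 : 0 < codebook_law P C.
  rewrite lt_neqAle codebook_law_ge0 // andbT eq_sym.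
  by apply: contraTneq hC => ->; rewrite !mul0r ltxx.
move: hC; rewrite ltr_pM2l // /total => /ltW.
have e0 : 0 <= codebook_error V1 u0 C.
  apply: sumr_ge0 => u _; apply: sumr_ge0 => b _.
  by rewrite !mulr_ge0 ?invr_ge0 ?(ltW U0).
have c0 : 0 <= #|{: msg * rnd}|%:R^-1 * (\sum_u cost (C u)).
  by rewrite mulr_ge0 ?invr_ge0 ?(ltW U0) // sumr_ge0.
have := codebook_divergence_ge0 u0.2 C0.
by exists C; split => //; lra.
Qed.

End ExistsCodebook.

(** * I.i.d. codewords over memoryless channels *)

Section Memoryless.
Context (R : realType) (X Y S : finType) (n : nat).
Variables (P : X -> R) (W : X -> Y * S -> R).

Definition iid_law (a : {ffun 'I_n -> X}) : R := \prod_i P (a i).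

(** Outputs form a pair of tuples, not a tuple of pairs, to match what the decoder and the
    eavesdropper observe in the model. *)
Definition memoryless (a : {ffun 'I_n -> X}) (b : n.-tuple Y * n.-tuple S) : R :=
  \prod_i W (a i) (tnth b.1 i, tnth b.2 i).

Lemma iid_law_pmf : is_pmf P -> is_pmf iid_law.
Proof.
move=> [P0 P1]; split; first by move=> a; apply: prodr_ge0.
rewrite /iid_law -(bigA_distr_bigA (fun (i : 'I_n) x => P x)).
by rewrite big1.
Qed.

Lemma memoryless_pmf a : (forall x, is_pmf (W x)) -> is_pmf (memoryless a).
Proof.
move=> W_pmf; split.
  by move=> b; apply: prodr_ge0 => i _; case: (W_pmf (a i)).
rewrite /memoryless (sum_tuple2_prod (fun i z => W (a i) z)) big1 // => i _.
by case: (W_pmf (a i)).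
Qed.

Lemma output_dist_memoryless b :
  output_dist iid_law memoryless b =
  \prod_i output_dist P W (tnth b.1 i, tnth b.2 i).
Proof.
rewrite /output_dist bigA_distr_bigA; apply: eq_bigr => a _.
by rewrite -big_split.
Qed.

Lemma sum_prod_letters (G : X -> Y * S -> R) :
  \sum_(a : {ffun 'I_n -> X}) \sum_(b : n.-tuple Y * n.-tuple S)
    \prod_i G (a i) (tnth b.1 i, tnth b.2 i) =
  (\sum_x \sum_z G x z) ^+ n.
Proof.
transitivity (\prod_(i < n) \sum_x \sum_z G x z); last first.
  by rewrite prodr_const card_ord.
rewrite bigA_distr_bigA; apply: eq_bigr => a _.
exact: (sum_tuple2_prod (fun i z => G (a i) z)).
Qed.

Lemma powR_prod (I : finType) (f : I -> R) (rho : R) : (forall i, 0 <= f i) ->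
  (\prod_i f i) `^ rho = \prod_i f i `^ rho.
Proof.
move=> f0; suff [] : 0 <= \prod_i f i /\ (\prod_i f i) `^ rho = \prod_i f i `^ rho by [].
elim/big_rec2 : _ => [|i x y _ [y0 yx]]; first by rewrite powR1.
by split; [exact: mulr_ge0|rewrite powRM // yx].
Qed.

Hypothesis P_ge0 : forall x, 0 <= P x.
Hypothesis W_ge0 : forall x z, 0 <= W x z.

Lemma memoryless_moment (rho : R) :
  \sum_a \sum_b iid_law a * (memoryless a b *
    (memoryless a b / output_dist iid_law memoryless b) `^ rho) =
  (\sum_x \sum_z P x * (W x z * (W x z / output_dist P W z) `^ rho)) ^+ n.
Proof.
rewrite -sum_prod_letters; apply: eq_bigr => a _; apply: eq_bigr => b _.
rewrite output_dist_memoryless /memoryless -prodf_div powR_prod -?big_split //.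
move=> i; rewrite divr_ge0 // sumr_ge0 // => x _; exact: mulr_ge0.
Qed.

Lemma memoryless_inverse_moment (rho : R) :
  \sum_a \sum_b iid_law a * (memoryless a b *
    (output_dist iid_law memoryless b / memoryless a b) `^ rho) =
  (\sum_x \sum_z P x * (W x z * (output_dist P W z / W x z) `^ rho)) ^+ n.
Proof.
rewrite -sum_prod_letters; apply: eq_bigr => a _; apply: eq_bigr => b _.
rewrite output_dist_memoryless /memoryless -prodf_div powR_prod -?big_split //.
move=> i; rewrite divr_ge0 // sumr_ge0 // => x _; exact: mulr_ge0.
Qed.

End Memoryless.

(** Expanding the square gives a double sum of centred terms; those at distinct coordinates vanish
    by independence, and the [n] diagonal ones are divided by [n^2]. *)
Lemma iid_mean_variance (R : realType) (X : finType) (n : nat) (P c : X -> R) :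
  is_pmf P -> (0 < n)%N ->
  let mu := \sum_x P x * c x in
  \sum_(a : {ffun 'I_n -> X}) iid_law P a *
    ((\sum_i c (a i)) / n%:R - mu) ^+ 2 =
  (\sum_x P x * (c x - mu) ^+ 2) / n%:R.
Proof.
move=> [P0 P1] n0 mu.
have nn : n%:R != 0 :> R by rewrite pnatr_eq0 -lt0n.
have c0 : \sum_x P x * (c x - mu) = 0.
  by under eq_bigr do rewrite mulrBr; rewrite sumrB -mulr_suml P1 mul1r subrr.
have E (a : {ffun 'I_n -> X}) : ((\sum_i c (a i)) / n%:R - mu) ^+ 2 =
    n%:R^-2 * \sum_i \sum_j (c (a i) - mu) * (c (a j) - mu).
  have -> : \sum_i \sum_j (c (a i) - mu) * (c (a j) - mu) =
      (\sum_i (c (a i) - mu)) ^+ 2.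
    by rewrite expr2 mulr_suml; apply: eq_bigr => i _; rewrite mulr_sumr.
  rewrite sumrB sumr_constE card_ord; field; exact: nn.
under eq_bigr do rewrite E mulrCA.
rewrite -mulr_sumr.
under eq_bigr do rewrite mulr_sumr.
rewrite exchange_big /=.
have F i : \sum_(a : {ffun 'I_n -> X}) iid_law P a *
    (\sum_j (c (a i) - mu) * (c (a j) - mu)) = \sum_x P x * (c x - mu) ^+ 2.
  under eq_bigr do rewrite mulr_sumr.
  rewrite exchange_big /= (bigD1 i) //= [X in _ + X]big1 ?addr0.
    by rewrite /iid_law (expect_ffun_coord (fun x => (c x - mu) * (c x - mu))).
  move=> j ji.
  rewrite /iid_law (expect_ffun_coord2 (fun x y => (c x - mu) * (c y - mu))) //;
    last by rewrite eq_sym.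
  under eq_bigr => x _.
    have -> : \sum_y P x * P y * ((c x - mu) * (c y - mu)) = 0; last over.
    transitivity (P x * (c x - mu) * \sum_y P y * (c y - mu)); last by rewrite c0 mulr0.
    by rewrite mulr_sumr; apply: eq_bigr => y _; ring.
  by rewrite big1.
under eq_bigr do rewrite F.
by rewrite sumr_constE card_ord; field; exact: nn.
Qed.

(** * Single-letter exponents and choice of the parameters *)

Section ChannelInformation.
Context (R : realType) (X Z : finType).
Variables (P : X -> R) (W : X -> Z -> R).
Hypothesis P_pmf : is_pmf P.
Hypothesis W_pmf : forall x, is_pmf (W x).

Local Notation Q := (output_dist P W).

(** Mutual information of input and output, as the mean of the information density
    [ln (W x z / Q z)]. *)
Definition channel_info : R :=
  \sum_x \sum_z P x * (W x z * ln (W x z / Q z)).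

Let P_ge0 x : 0 <= P x. Proof. by case: P_pmf. Qed.
Let W_ge0 x z : 0 <= W x z. Proof. by case: (W_pmf x). Qed.

Lemma input_output_pmf : is_pmf (fun xz => P xz.1 * W xz.1 xz.2).
Proof.
split; first by move=> xz; exact: mulr_ge0.
rewrite -(pair_bigA _ (fun x z => P x * W x z)) /=; case: P_pmf => _ <-.
by apply: eq_bigr => x _; rewrite -mulr_sumr (W_pmf x).2 mulr1.
Qed.

Lemma output_letter_gt0 x z : P x * W x z != 0 -> 0 < W x z /\ 0 < Q z.
Proof.
move=> xz0; have xz : 0 < P x * W x z by rewrite lt_neqAle eq_sym xz0 mulr_ge0.
split.
  by rewrite lt_neqAle W_ge0 andbT eq_sym; apply: contraNneq xz0 => ->; rewrite mulr0.
apply: lt_le_trans xz _; rewrite /output_dist (bigD1 x) //= lerDl.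
by apply: sumr_ge0 => y _; exact: mulr_ge0.
Qed.

Lemma channel_info_ge0 : 0 <= channel_info.
Proof.
apply: sumr_ge0 => x _; rewrite -mulr_sumr.
have [->|Px] := eqVneq (P x) 0; first by rewrite mul0r.
rewrite mulr_ge0 //; apply: divergence_ge0 => //.
- by move=> z; exact: output_dist_ge0.
- by rewrite (W_pmf x).2 (output_dist_pmf P_pmf W_pmf).2.
move=> z Qz; apply/eqP; apply/negPn/negP => Wz.
by have [_] := output_letter_gt0 (mulf_neq0 Px Wz); rewrite Qz ltxx.
Qed.

(** This is [exp_moment_le] for the information density under the joint law. Off the support of that
    law the terms vanish; on it the power is [exp (rho * ln _)]. *)
Lemma channel_moment_le (e : R) : 0 < e -> exists2 rho0 : R, 0 < rho0 &
  forall rho, 0 < rho <= rho0 ->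
    \sum_x \sum_z P x * (W x z * (W x z / Q z) `^ rho) <=
    expR (rho * (channel_info + e)).
Proof.
move=> e0.
have [rho0 rho00 h] := exp_moment_le
  (fun xz => ln (W xz.1 xz.2 / Q xz.2)) input_output_pmf e0.
exists rho0 => // rho hrho; apply: (le_trans _ (le_trans (h rho hrho) _)).
  rewrite pair_bigA /=; apply: ler_sum => -[x z] _ /=; rewrite mulrA.
  have [->|xz] := eqVneq (P x * W x z) 0; first by rewrite !mul0r.
  have [Wz Qz] := output_letter_gt0 xz.
  by rewrite /powR gt_eqF ?divr_gt0.
rewrite /channel_info pair_bigA /=.
by under [in leRHS]eq_bigr do rewrite mulrA; rewrite lexx.
Qed.

(** The same expansion for the negated information density, whence the sign of [channel_info]. *)
Lemma channel_inverse_moment_le (e : R) : 0 < e ->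
  exists2 rho0 : R, 0 < rho0 & forall rho, 0 < rho <= rho0 ->
    \sum_x \sum_z P x * (W x z * (Q z / W x z) `^ rho) <=
    expR (rho * (- channel_info + e)).
Proof.
move=> e0.
have [rho0 rho00 h] := exp_moment_le
  (fun xz => ln (Q xz.2 / W xz.1 xz.2)) input_output_pmf e0.
exists rho0 => // rho hrho; apply: (le_trans _ (le_trans (h rho hrho) _)).
  rewrite pair_bigA /=; apply: ler_sum => -[x z] _ /=; rewrite mulrA.
  have [->|xz] := eqVneq (P x * W x z) 0; first by rewrite !mul0r.
  have [Wz Qz] := output_letter_gt0 xz.
  by rewrite /powR gt_eqF ?divr_gt0.
rewrite /channel_info pair_bigA /= -sumrN.
rewrite (eq_bigr (fun xz => - (P xz.1 * (W xz.1 xz.2 * ln (W xz.1 xz.2 / Q xz.2))))) //.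
move=> [x z] _ /=; rewrite mulrA.
have [->|xz] := eqVneq (P x * W x z) 0; first by rewrite !mul0r oppr0.
have [Wz Qz] := output_letter_gt0 xz.
by rewrite !ln_div ?posrE // -mulrN opprB.
Qed.

End ChannelInformation.

Lemma expRN_le_inv (R : realType) (x : R) : 0 < x -> expR (- x) <= x^-1.
Proof.
move=> x0; rewrite expRN lef_pV2 ?posrE ?expR_gt0 //.
by apply: le_trans (expR_ge1Dx x); lra.
Qed.

(** * Choice of blocklength and rates *)

Section WiretapCodebook.
Context (R : realType) (X Y1 S1 Y2 S2 : finType).
Variables (P : X -> R) (W1 : X -> Y1 * S1 -> R) (W2 : X -> Y2 * S2 -> R).
Variables (c1 c2 : X -> R).
Hypothesis P_pmf : is_pmf P.
Hypothesis W1_pmf : forall x, is_pmf (W1 x).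
Hypothesis W2_pmf : forall x, is_pmf (W2 x).

Lemma exists_wiretap_codebook (r delta : R) :
  0 < delta -> r <= channel_info P W1 - channel_info P W2 ->
  exists (n M K : nat)
    (C : {ffun 'I_M.+1 * 'I_K.+1 -> {ffun 'I_n -> X}}),
  let avg (c : X -> R) := #|{: 'I_M.+1 * 'I_K.+1}|%:R^-1 *
    \sum_u (\sum_i c (C u i)) / n%:R in
  [/\ (0 < n)%N, 0 < codebook_law (iid_law P) C & r - delta <= ln M.+1%:R / n%:R] /\
  [/\ codebook_error (memoryless W1) (ord0, ord0) C <= delta,
      codebook_divergence (iid_law P) (memoryless W2) C <= delta,
      avg c1 <= \sum_x P x * c1 x + delta &
      avg c2 <= \sum_x P x * c2 x + delta].
Proof.
move=> d0 hr; case: (P_pmf) => P0 P1.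
have W10 x z : 0 <= W1 x z by case: (W1_pmf x).
have W20 x z : 0 <= W2 x z by case: (W2_pmf x).
set I1 := channel_info P W1 in hr; set I2 := channel_info P W2 in hr.
have I20 : 0 <= I2 by exact: channel_info_ge0.
have e0 : 0 < delta / 6 by lra.
have [r1 r10 h1] := channel_inverse_moment_le P_pmf W1_pmf e0.
have [r2 r20 h2] := channel_moment_le P_pmf W2_pmf e0.
pose rho := Num.min 1 (Num.min r1 r2).
have rho0 : 0 < rho by rewrite !lt_min ltr01 r10.
have [rho_le1 rho_r1 rho_r2] : [/\ rho <= 1, rho <= r1 & rho <= r2].
  by rewrite /rho !ge_min !lexx !orbT.
have {h1} := h1 rho; rewrite rho0 rho_r1 -/I1 => /(_ isT) h1.
have {h2} := h2 rho; rewrite rho0 rho_r2 -/I2 => /(_ isT) h2.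
pose mu1 := \sum_x P x * c1 x; pose mu2 := \sum_x P x * c2 x.
pose v1 := \sum_x P x * (c1 x - mu1) ^+ 2.
pose v2 := \sum_x P x * (c2 x - mu2) ^+ 2.
have v10 : 0 <= v1 by apply: sumr_ge0 => x _; rewrite mulr_ge0 ?sqr_ge0.
have v20 : 0 <= v2 by apply: sumr_ge0 => x _; rewrite mulr_ge0 ?sqr_ge0.
(* The three terms correspond to error, divergence and cost: each expected value is at most its term
   over [n]. Exponential decay is weakened to [1 / n] by [expRN_le_inv], so [n > A / delta]
   suffices. *)
pose A := 4 / (rho * delta) + 6 / (rho ^+ 2 * delta) + delta^-1 * (v1 + v2).
pose n := (Num.truncn (A / delta)).+1.
have n0 : (0 < n)%N by [].
have nn0 : (0 : R) < n%:R by rewrite ltr0n.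
have An : A / n%:R < delta.
  rewrite ltr_pdivrMr // mulrC -ltr_pdivrMr //.
  exact: truncnS_gt.
(* With slack [delta / 6] in each moment, the exponents divided by [n * rho] are at most
   [Rm + Rk - I1 + delta / 6 <= - delta / 2] for the error and [I2 + delta / 6 - Rk = - delta / 6]
   for the divergence. *)
pose Rm := r - delta; pose Rk := I2 + delta / 3.
(* [Rm] may be negative; then [M = 0], there is one message and no error. *)
pose M := Num.truncn (expR (n%:R * Rm)); pose K := Num.truncn (expR (n%:R * Rk)).
have M_le : M%:R <= expR (n%:R * Rm) by rewrite truncn_le ?expR_ge0.
have M_gt : expR (n%:R * Rm) < M.+1%:R by exact: truncnS_gt.
have K_gt : expR (n%:R * Rk) < K.+1%:R by exact: truncnS_gt.
(* Since [Rk >= 0], the exponential is at least [1], so rounding up costs at most a factor [2]. *)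
have K_le : K.+1%:R <= 2 * expR (n%:R * Rk).
  have : K%:R <= expR (n%:R * Rk) by rewrite truncn_le ?expR_ge0.
  have : 1 <= expR (n%:R * Rk) by rewrite -expR0 ler_expR mulr_ge0 ?(ltW nn0) // /Rk; lra.
  by rewrite -natr1; lra.
pose dev (c : X -> R) mu (a : {ffun 'I_n -> X}) := ((\sum_i c (a i)) / n%:R - mu) ^+ 2.
(* Squared deviations scaled by [1 / delta]: a mean cost at most [delta] will mean a mean squared
   deviation at most [delta^2]. *)
pose cost a := delta^-1 * (dev c1 mu1 a + dev c2 mu2 a).
have cost0 a : 0 <= cost a.
  by rewrite mulr_ge0 ?addr_ge0 ?sqr_ge0 // invr_ge0 ltW.
have hrho : 0 < rho <= 1 by rewrite rho0.
have errB : (#|'I_M.+1|.-1 * #|'I_K.+1|)%:R `^ rho *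
    (\sum_(a : {ffun 'I_n -> X}) \sum_(b : n.-tuple Y1 * n.-tuple S1)
      iid_law P a * (memoryless W1 a b *
      (output_dist (iid_law P) (memoryless W1) b / memoryless W1 a b) `^ rho)) <=
    4 / (rho * delta) / n%:R.
  rewrite !card_ord (memoryless_inverse_moment n P0 W10 rho) /=.
  apply: (@le_trans _ _ ((2 * expR (n%:R * Rm + n%:R * Rk)) `^ rho *
      expR (rho * (- I1 + delta / 6)) ^+ n)).
    rewrite ler_pM ?powR_ge0 ?exprn_ge0 //.
    - by apply: sumr_ge0 => x _; apply: sumr_ge0 => z _; rewrite !mulr_ge0 ?powR_ge0.
    - rewrite ge0_ler_powR ?nnegrE ?(ltW rho0) ?mulr_ge0 ?expR_ge0 //.
      rewrite natrM expRD mulrCA ler_pM //.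
    - rewrite lerXn2r ?nnegrE ?expR_ge0 // sumr_ge0 // => x _.
      by apply: sumr_ge0 => z _; rewrite !mulr_ge0 ?powR_ge0.
  rewrite powRM ?expR_ge0 // -expRM -expRM_natl -mulrA -expRD.
  apply: (@le_trans _ _ (2 * expR (- (n%:R * rho * delta / 2)))).
    rewrite ler_pM ?powR_ge0 ?expR_ge0 //.
      by rewrite -[leRHS]powRr1 // ler_powR // ler1n.
    rewrite ler_expR /Rm /Rk.
    have -> : (n%:R * (r - delta) + n%:R * (I2 + delta / 3)) * rho +
        n%:R * (rho * (- I1 + delta / 6)) =
      n%:R * rho * (r - (I1 - I2) - delta / 2) by field.
    have h : 0 < n%:R * rho by exact: mulr_gt0.
    nra.
  have -> : 4 / (rho * delta) / n%:R = 2 * (n%:R * rho * delta / 2)^-1.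
    by field; rewrite !gt_eqF.
  by rewrite ler_wpM2l // expRN_le_inv // !mulr_gt0.
have divB : rho^-1 * #|'I_K.+1|%:R `^ (- rho) *
    (\sum_(a : {ffun 'I_n -> X}) \sum_(b : n.-tuple Y2 * n.-tuple S2)
      iid_law P a * (memoryless W2 a b *
      (memoryless W2 a b / output_dist (iid_law P) (memoryless W2) b) `^ rho)) <=
    6 / (rho ^+ 2 * delta) / n%:R.
  rewrite !card_ord (memoryless_moment n P0 W20 rho).
  apply: (@le_trans _ _ (rho^-1 * expR (n%:R * Rk * - rho) *
      expR (rho * (I2 + delta / 6)) ^+ n)).
    rewrite ler_pM ?mulr_ge0 ?invr_ge0 ?(ltW rho0) ?powR_ge0 ?exprn_ge0 //.
    - by apply: sumr_ge0 => x _; apply: sumr_ge0 => z _; rewrite !mulr_ge0 ?powR_ge0.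
    - rewrite ler_wpM2l ?invr_ge0 ?(ltW rho0) // mulrN expRN powRN expRM.
      rewrite lef_pV2 ?posrE ?powR_gt0 ?expR_gt0 //.
      by rewrite ge0_ler_powR ?nnegrE ?(ltW rho0) ?expR_ge0 // ltW.
    - rewrite lerXn2r ?nnegrE ?expR_ge0 // sumr_ge0 // => x _.
      by apply: sumr_ge0 => z _; rewrite !mulr_ge0 ?powR_ge0.
  rewrite -expRM_natl -mulrA -expRD.
  have -> : n%:R * Rk * - rho + n%:R * (rho * (I2 + delta / 6)) =
      - (n%:R * rho * delta / 6) by rewrite /Rk; field.
  have -> : 6 / (rho ^+ 2 * delta) / n%:R = rho^-1 * (n%:R * rho * delta / 6)^-1.
    by field; rewrite !gt_eqF.
  by rewrite ler_wpM2l ?invr_ge0 ?(ltW rho0) // expRN_le_inv // !mulr_gt0.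
have costE : \sum_a iid_law P a * cost a = delta^-1 * (v1 + v2) / n%:R.
  under eq_bigr do rewrite /cost mulrCA mulrDr.
  by rewrite -mulr_sumr big_split /= !iid_mean_variance // -mulrDl mulrA.
have := @exists_codebook R _ _ _ 'I_M.+1 'I_K.+1 _ (memoryless W1) (memoryless W2) cost
  (iid_law_pmf n P_pmf) (fun a => memoryless_pmf a W1_pmf)
  (fun a => memoryless_pmf a W2_pmf) cost0 (ord0, ord0) rho delta hrho.
case.
  apply: le_lt_trans An; rewrite costE [A / _]mulrDl.
  by rewrite lerD // [leRHS]mulrDl lerD.
move=> C [C0 Cerr Cdiv Ccost].
have U0 : (0 : R) < #|{: 'I_M.+1 * 'I_K.+1}|%:R.
  by rewrite ltr0n; apply/card_gt0P; exists (ord0, ord0).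
have avgB c mu : (forall a, delta^-1 * dev c mu a <= cost a) ->
    #|{: 'I_M.+1 * 'I_K.+1}|%:R^-1 * (\sum_u (\sum_i c (C u i)) / n%:R) <= mu + delta.
  move=> dev_le; rewrite ler_pdivrMl //.
  rewrite ler_pdivrMl // in Ccost.
  apply: (@le_trans _ _ (\sum_u ((mu + delta / 2) + 2^-1 * cost (C u)))).
    apply: ler_sum => u _.
    (* Completing the square: [y - mu <= delta / 2 + (y - mu)^2 / (2 * delta)]. Averaged over the
       codebook, the last term is at most another [delta / 2]. *)
    apply: (@le_trans _ _ (mu + delta / 2 + 2^-1 * (delta^-1 * dev c mu (C u)))); last first.
      by rewrite lerD2l ler_wpM2l.
    rewrite /dev; set y := _ / _.
    rewrite -subr_ge0.
    have -> : mu + delta / 2 + 2^-1 * (delta^-1 * (y - mu) ^+ 2) - y =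
      2^-1 * delta^-1 * (y - mu - delta) ^+ 2.
      by field; rewrite gt_eqF.
    by rewrite mulr_ge0 ?sqr_ge0 // mulr_ge0 // invr_ge0 ltW.
  rewrite big_split /= sumr_constE -mulr_sumr; lra.
exists n, M, K, C; split; split => //.
- rewrite ler_pdivlMr // mulrC -ler_expR lnK ?posrE ?ltr0n //.
  exact: ltW.
- apply: avgB => a; rewrite ler_wpM2l ?invr_ge0 ?(ltW d0) // lerDl sqr_ge0 //.
- apply: avgB => a; rewrite ler_wpM2l ?invr_ge0 ?(ltW d0) // lerDr sqr_ge0 //.
Qed.

End WiretapCodebook.

(** * The code of a codebook *)

Lemma le_Pr (R : realType) (O : finType) (P : O -> R) (E F : pred O) :
  (forall w, 0 <= P w) -> subpred E F -> Pr P E <= Pr P F.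
Proof.
move=> P0 EF; rewrite /Pr big_mkcond [leRHS]big_mkcond /=; apply: ler_sum => w _.
by case: ifP => [/EF ->|_] //; case: ifP.
Qed.

Lemma sum_Pr_fiber (R : realType) (O A : finType) (P : O -> R) (X : O -> A)
    (E : pred O) :
  \sum_a Pr P [pred w | (X w == a) && E w] = Pr P E.
Proof.
rewrite /Pr (partition_big X xpredT) //=; apply: eq_bigr => a _.
by apply: eq_bigl => w; rewrite andbC.
Qed.

(* The right-hand side exceeds the mutual information by the divergence of the
   law of [(Y, Z)] from the reference law [Q]. *)
Lemma cond_mutual_info_le (R : realType) (O A B C : finType) (P : O -> R)
    (X : O -> A) (Y : O -> B) (Z : O -> C) (Q : B * C -> R) :
  is_pmf P -> is_pmf Q ->
  (forall a c, Pr P [pred w | (X w == a) && (Z w == c)] =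
     Pr P [pred w | X w == a] * Pr P [pred w | Z w == c]) ->
  (forall b c, Q (b, c) = 0 -> Pr P [pred w | (Y w == b) && (Z w == c)] = 0) ->
  cond_mutual_info P X Y Z <=
  \sum_a \sum_(bc : B * C)
    let pabc := Pr P [pred w | [&& X w == a, Y w == bc.1 & Z w == bc.2]] in
    pabc * ln (pabc / (Pr P [pred w | X w == a] * Q bc)).
Proof.
move=> [P0 P1] [Q0 Q1] indep ac.
pose p3 a bc := Pr P [pred w | [&& X w == a, Y w == bc.1 & Z w == bc.2]].
pose pyz bc := Pr P [pred w | (Y w == bc.1) && (Z w == bc.2)].
have Pr0 E : 0 <= Pr P E by exact: sumr_ge0.
have yz_sum : \sum_(bc : B * C) pyz bc = 1.
  rewrite -(pair_bigA _ (fun b c => pyz (b, c))) exchange_big /=.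
  under eq_bigr do rewrite (sum_Pr_fiber P Y (fun w => Z w == _)).
  transitivity (Pr P xpredT); last by [].
  rewrite -(sum_Pr_fiber P Z); apply: eq_bigr => c _.
  by apply: eq_bigl => w; rewrite /= andbT.
(* After summation over [a] this is the divergence of the law of [(Y, Z)] from [Q]. *)
have div0 : 0 <= \sum_a \sum_bc p3 a bc * ln (pyz bc / Q bc).
  rewrite exchange_big /=.
  have -> : \sum_bc \sum_a p3 a bc * ln (pyz bc / Q bc) =
      \sum_bc pyz bc * ln (pyz bc / Q bc).
    apply: eq_bigr => bc _; rewrite -mulr_suml; congr (_ * _).
    exact: (sum_Pr_fiber P X (fun w => (Y w == bc.1) && (Z w == bc.2))).
  apply: divergence_ge0 => [bc|//||[b c]]; [exact: Pr0| |exact: ac].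
  by rewrite yz_sum Q1.
rewrite -subr_ge0; apply: (le_trans div0).
rewrite /cond_mutual_info -sumrB; apply: ler_sum => a _.
rewrite (pair_bigA _ (fun b c => _)) /= -sumrB; apply: ler_sum => -[b c] _ /=.
rewrite -/(p3 a (b, c)) indep.
set pa := Pr P [pred w | X w == a]; set pc := Pr P [pred w | Z w == c].
rewrite -[Pr P [pred w | (Y w == b) && (Z w == c)]]/(pyz (b, c)).
have [->|p3n0] := eqVneq (p3 a (b, c)) 0; first by rewrite !mul0r subr0.
have p3_gt0 : 0 < p3 a (b, c) by rewrite lt_neqAle eq_sym p3n0 Pr0.
have pa0 : 0 < pa.
  by apply: lt_le_trans p3_gt0 _; apply: le_Pr => // w /= /and3P[].
have pc0 : 0 < pc.
  by apply: lt_le_trans p3_gt0 _; apply: le_Pr => // w /= /and3P[].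
have pyz0 : 0 < pyz (b, c).
  by apply: lt_le_trans p3_gt0 _; apply: le_Pr => // w /= /and3P[_ -> ->].
have Qbc : 0 < Q (b, c).
  rewrite lt_neqAle Q0 andbT eq_sym; apply: contraTneq pyz0 => /ac.
  by rewrite /pyz /= => ->; rewrite ltxx.
rewrite !(ln_div, lnM) ?posrE ?mulr_gt0 //; lra.
Qed.

Lemma card_ordS_gt0 (m : nat) : (0 < #|'I_m.+1|)%N.
Proof. by rewrite card_ord. Qed.

Section CodebookCode.
Context (R : realType) (X S1 S2 T1 T2 Y1 Y2 : finType).
Variable ch : isac_channel R X S1 S2 Y1 Y2.

Definition letter_law (x : X) (z : (S1 * S2) * (Y1 * Y2)) : R :=
  state_law ch z.1 * output_law ch z.1 x z.2.

Lemma letter_law_ge0 x z : 0 <= letter_law x z.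
Proof.
by rewrite mulr_ge0 //; [case: (state_lawP ch)|case: (output_lawP ch z.1 x)].
Qed.

Lemma letter_law_sum (p : pred (S1 * S2)) x :
  \sum_(z | p z.1) letter_law x z = \sum_(s | p s) state_law ch s.
Proof.
rewrite [RHS]big_mkcond [LHS]big_mkcond /=.
rewrite -(pair_bigA _ (fun s y => if p s then letter_law x (s, y) else 0)) /=.
apply: eq_bigr => s _; case: (p s); last by rewrite big1.
by rewrite /letter_law /= -mulr_sumr (output_lawP ch s x).2 mulr1.
Qed.

Lemma letter_law_sum1 x : \sum_z letter_law x z = 1.
Proof. by rewrite (letter_law_sum xpredT); case: (state_lawP ch). Qed.

Section Observed.
Context (S Y : finType) (f : S1 * S2 -> S) (g : Y1 * Y2 -> Y).

(** The state known to an observer is made part of the channel output; receiver and eavesdropper are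
    then two instances, given by the projections [f] and [g]. *)
Definition observed_channel (x : X) (b : Y * S) : R :=
  \sum_(z | (f z.1 == b.2) && (g z.2 == b.1)) letter_law x z.

Lemma observed_channel_pmf x : is_pmf (observed_channel x).
Proof.
split; first by move=> b; apply: sumr_ge0 => z _; exact: letter_law_ge0.
rewrite -(letter_law_sum1 x).
rewrite (partition_big (fun z => (g z.2, f z.1)) xpredT) //=.
by apply: eq_bigr => -[y s] _; apply: eq_bigl => z; rewrite xpair_eqE andbC.
Qed.

Lemma sum_observed_output x s :
  \sum_y observed_channel x (y, s) = \sum_(s' | f s' == s) state_law ch s'.
Proof.
rewrite -(letter_law_sum (fun s' => f s' == s) x).
by rewrite (partition_big (fun z => g z.2) xpredT).
Qed.

Lemma sum_memoryless_observed n (a : {ffun 'I_n -> X})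
    (F : n.-tuple Y * n.-tuple S -> R) :
  \sum_(b : n.-tuple (S1 * S2) * n.-tuple (Y1 * Y2))
    (\prod_i letter_law (a i) (tnth b.1 i, tnth b.2 i)) *
      F (map_tuple g b.2, map_tuple f b.1) =
  \sum_c memoryless observed_channel a c * F c.
Proof.
rewrite (partition_big
  (fun b : n.-tuple (S1 * S2) * n.-tuple (Y1 * Y2) =>
     (map_tuple g b.2, map_tuple f b.1)) xpredT) //=.
apply: eq_bigr => -[y s] _.
rewrite /memoryless -(marginal_tuple2_prod f g (fun i z => letter_law (a i) z)).
rewrite mulr_suml; apply: eq_big => [b|b /eqP -> //].
by rewrite xpair_eqE andbC.
Qed.

(** The law of the observed states does not depend on the codeword. This is what makes the message
    independent of the eavesdropper's state sequence. *)
Lemma sum_memoryless_observed_output n (a : {ffun 'I_n -> X}) (s : n.-tuple S) :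
  \sum_(y : n.-tuple Y) memoryless observed_channel a (y, s) =
  \prod_i \sum_(s' | f s' == tnth s i) state_law ch s'.
Proof.
rewrite /memoryless (sum_tuple_prod (fun i y => observed_channel (a i) (y, tnth s i))).
by apply: eq_bigr => i _; exact: sum_observed_output.
Qed.

End Observed.

Definition receiver_channel := observed_channel fst fst.
Definition eavesdropper_channel := observed_channel snd snd.

Context (n M K : nat) (C : {ffun 'I_M.+1 * 'I_K.+1 -> {ffun 'I_n -> X}}).
Context (h1 : X -> Y1 -> Y2 -> T1) (h2 : X -> Y1 -> Y2 -> T2).

Lemma uniform_pmf : is_pmf (fun _ : 'I_K.+1 => K.+1%:R^-1 : R).
Proof.
split; first by move=> k; rewrite invr_ge0.
by rewrite sumr_constE card_ord divff // pnatr_eq0.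
Qed.

Definition letterwise (T : Type) (h : X -> Y1 -> Y2 -> T)
    (x : n.-tuple X) (y1 : n.-tuple Y1) (y2 : n.-tuple Y2) : n.-tuple T :=
  [tuple h (tnth x i) (tnth y1 i) (tnth y2 i) | i < n].

Definition codebook_code : isac_code R X S1 S2 T1 T2 Y1 Y2 n :=
  @IsacCode R X S1 S2 T1 T2 Y1 Y2 n 'I_M.+1 (card_ordS_gt0 M)
    'I_K.+1 _ uniform_pmf
    (fun i m k _ => C (m, k) i)
    (fun y s => ml_decode (memoryless receiver_channel) (ord0, ord0) C (y, s))
    (letterwise h1) (letterwise h2).

Local Notation joint := (joint_law ch (c := codebook_code)).
Local Notation U := ('I_M.+1 * 'I_K.+1)%type.

(** The pair of message and local randomness is uniform, and given it the letters are independent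
    because the encoder ignores feedback. Error, distortion and leakage are all computed from this
    formula. *)
Lemma expect_codebook_code (F : sample codebook_code -> R) :
  \sum_w joint w * F w =
  \sum_(u : U) #|{: U}|%:R^-1 *
    \sum_(b : n.-tuple (S1 * S2) * n.-tuple (Y1 * Y2))
      (\prod_i letter_law (C u i) (tnth b.1 i, tnth b.2 i)) * F (u, b.1, b.2).
Proof.
rewrite (reindex (fun p : U * (n.-tuple (S1 * S2) * n.-tuple (Y1 * Y2)) =>
   (p.1, p.2.1, p.2.2) : sample codebook_code)) /=; last first.
  by exists (fun w => (w.1.1, (w.1.2, w.2))) => [[? []]|[[]]].
rewrite -(pair_bigA _ (fun u b => joint (u, b.1, b.2) * F (u, b.1, b.2))) /=.
apply: eq_bigr => u _; rewrite mulr_sumr; apply: eq_bigr => b _.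
rewrite mulrA; congr (_ * _).
rewrite /joint_law card_prod natrM invfM /= !card_ord; congr (_ * _).
apply: eq_bigr => i _; rewrite /inputs tnth_mktuple /message /randomness /=.
by rewrite -surjective_pairing.
Qed.

Lemma joint_law_pmf : is_pmf joint.
Proof.
split.
  move=> w; rewrite /joint_law !mulr_ge0 ?invr_ge0 //.
  apply: prodr_ge0 => i _.
  exact: (letter_law_ge0 (tnth (inputs w) i) (tnth (states w) i, tnth (outputs w) i)).
under eq_bigr do rewrite -[joint _]mulr1.
rewrite (expect_codebook_code (fun=> 1)).
under eq_bigr => u _.
  under eq_bigr do rewrite mulr1.
  rewrite (sum_tuple2_prod (fun i z => letter_law (C u i) z)) big1 ?mulr1.
    over.
  by move=> i _; exact: letter_law_sum1.
by rewrite sumr_constE divff // pnatr_eq0 card_prod !card_ord.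
Qed.

Lemma PrE_codebook_code (E : pred (sample codebook_code)) :
  Pr joint E = \sum_w joint w * (E w)%:R.
Proof.
by rewrite /Pr big_mkcond; apply: eq_bigr => w _; case: (E w); rewrite ?mulr1 ?mulr0.
Qed.

Lemma codebook_code_error :
  error_prob ch codebook_code =
  codebook_error (memoryless receiver_channel) (ord0, ord0) C.
Proof.
rewrite /error_prob PrE_codebook_code expect_codebook_code /codebook_error.
apply: eq_bigr => u _; rewrite -mulr_sumr; congr (_ * _).
exact: (sum_memoryless_observed fst fst (C u)
  (fun c => (ml_decode (memoryless receiver_channel) (ord0, ord0) C c != u.1)%:R)).
Qed.

Lemma codebook_code_distortion (S T : finType) (f : S1 * S2 -> S)
    (h : X -> Y1 -> Y2 -> T) (d : S -> T -> R) :
  Expect joint (fun w => avg_distortion d (map_tuple f (states w))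
    (letterwise h (inputs w) (output1 w) (output2 w))) =
  #|{: U}|%:R^-1 * \sum_u
    (\sum_i \sum_z letter_law (C u i) z * d (f z.1) (h (C u i) z.2.1 z.2.2)) / n%:R.
Proof.
rewrite /Expect expect_codebook_code -mulr_sumr; congr (_ * _).
apply: eq_bigr => u _.
under eq_bigr do rewrite /avg_distortion mulrA mulr_sumr.
rewrite -mulr_suml exchange_big /=; congr (_ / _); apply: eq_bigr => i _.
rewrite -(expect_tuple2_coord (F := fun i z => letter_law (C u i) z)
  (fun s y => d (f s) (h (C u i) y.1 y.2))) => [|j]; last exact: letter_law_sum1.
apply: eq_bigr => b _; congr (_ * _).
rewrite /letterwise /inputs !tnth_mktuple /output1 /output2 !tnth_map.
by rewrite /message /randomness /states /outputs /= -surjective_pairing.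
Qed.

(** [cond_mutual_info_le] is applied with the i.i.d. output law as reference. The uniform
    probability of the message cancels inside the logarithm, leaving the average divergence. *)
Lemma codebook_code_leakage (P : X -> R) : is_pmf P ->
  0 < codebook_law (iid_law P) C ->
  leakage ch codebook_code <=
  codebook_divergence (iid_law P) (memoryless eavesdropper_channel) C.
Proof.
move=> P_pmf C0.
set V2 := memoryless eavesdropper_channel.
have V2_pmf a : is_pmf (V2 a) by apply: memoryless_pmf => x; exact: observed_channel_pmf.
have K0 : (K.+1%:R : R) != 0 by rewrite pnatr_eq0.
have M0 : (M.+1%:R : R) != 0 by rewrite pnatr_eq0.
(* Averaging out the local randomness: given the message [m], the eavesdropper's observation has law
   [msg_output_dist V2 C m]. *)
have law (F : 'I_M.+1 -> n.-tuple Y2 * n.-tuple S2 -> R) :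
    \sum_w joint w * F (message w) (output2 w, state2 w) =
    M.+1%:R^-1 * \sum_m \sum_c msg_output_dist V2 C m c * F m c.
  rewrite (expect_codebook_code (fun w => F (message w) (output2 w, state2 w))).
  transitivity (\sum_m \sum_k #|{: U}|%:R^-1 * \sum_c V2 (C (m, k)) c * F m c).
    rewrite pair_bigA /=; apply: eq_bigr => -[m k] _; congr (_ * _).
    exact: (sum_memoryless_observed snd snd (C (m, k)) (F m)).
  rewrite mulr_sumr; apply: eq_bigr => m _.
  rewrite card_prod !card_ord natrM invfM.
  rewrite -mulr_sumr -mulrA exchange_big /= mulr_sumr; congr (_ * _).
  apply: eq_bigr => c _; rewrite /msg_output_dist card_ord -mulrA; congr (_ * _).
  by rewrite mulr_suml.
pose ps (s : n.-tuple S2) := \prod_i \sum_(s' | s'.2 == tnth s i) state_law ch s'.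
have mod_sum1 m : \sum_c msg_output_dist V2 C m c = 1.
  by case: (msg_output_dist_pmf V2_pmf C m ord0).
have mod_s m s : \sum_c msg_output_dist V2 C m c * (c.2 == s)%:R = ps s.
  rewrite -(pair_bigA _ (fun y s' => msg_output_dist V2 C m (y, s') * (s' == s)%:R)) /=.
  under eq_bigr => y _.
    rewrite (bigD1 s) //= eqxx mulr1 big1 ?addr0; last first.
      by move=> s' /negbTE ->; rewrite mulr0.
    over.
  rewrite /msg_output_dist -mulr_sumr exchange_big /=.
  under eq_bigr do rewrite (sum_memoryless_observed_output snd snd).
  by rewrite sumr_constE card_ord mulKf.
have pr_m m : Pr joint [pred w | message w == m] = M.+1%:R^-1.
  rewrite PrE_codebook_code (law (fun m' _ => (m' == m)%:R)) /=.
  rewrite (bigD1 m) //= eqxx -mulr_suml mod_sum1 mulr1 big1 ?addr0 ?mulr1 //.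
  by move=> m' /negbTE ->; rewrite -mulr_suml mulr0.
have pr_s s : Pr joint [pred w | state2 w == s] = ps s.
  rewrite PrE_codebook_code (law (fun _ c => (c.2 == s)%:R)) /=.
  under eq_bigr do rewrite mod_s.
  by rewrite sumr_constE card_ord mulKf.
have pr_ms m s : Pr joint [pred w | (message w == m) && (state2 w == s)] =
    M.+1%:R^-1 * ps s.
  rewrite PrE_codebook_code (law (fun m' c => ((m' == m) && (c.2 == s))%:R)) /=.
  rewrite (bigD1 m) //= eqxx /= mod_s big1 ?addr0 //.
  by move=> m' /negbTE ->; rewrite big1 // => c _; rewrite mulr0.
have pr_mys m c : Pr joint [pred w | [&& message w == m, output2 w == c.1 & state2 w == c.2]] =
    M.+1%:R^-1 * msg_output_dist V2 C m c.
  rewrite PrE_codebook_code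
    (law (fun m' c' => ([&& m' == m, c'.1 == c.1 & c'.2 == c.2])%:R)) /=.
  congr (_ * _); rewrite (bigD1 m) //= eqxx /= [X in _ + X]big1 ?addr0; last first.
    by move=> m' /negbTE ->; rewrite big1 // => c' _; rewrite mulr0.
  rewrite (bigD1 c) //= !eqxx mulr1 big1 ?addr0 // => c' c'c.
  by rewrite -xpair_eqE -!surjective_pairing (negbTE c'c) mulr0.
have pr_ys c : Pr joint [pred w | (output2 w == c.1) && (state2 w == c.2)] =
    M.+1%:R^-1 * \sum_m msg_output_dist V2 C m c.
  rewrite -(sum_Pr_fiber joint (@message _ _ _ _ _ _ _ _ _ codebook_code)
    (fun w => (output2 w == c.1) && (state2 w == c.2))) mulr_sumr.
  by apply: eq_bigr => m _; exact: pr_mys.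
have Q_pmf := output_dist_pmf (iid_law_pmf n P_pmf) V2_pmf.
apply: (le_trans (cond_mutual_info_le joint_law_pmf Q_pmf _ _)).
- by move=> m s; rewrite pr_ms pr_m pr_s.
- move=> y s Q0; rewrite (pr_ys (y, s)) big1 ?mulr0 // => m _.
  by rewrite (msg_output_dist_ac (iid_law_pmf n P_pmf) V2_pmf).
rewrite /codebook_divergence card_ord; apply: ler_sum => m _.
rewrite mulr_sumr; apply: ler_sum => c _ /=.
by rewrite pr_mys pr_m -mulrA -mulf_div divff ?mul1r // invr_neq0.
Qed.

End CodebookCode.

(** * The BEC-BSC channel *)

(** The coding theorem for arbitrary finite alphabets and letterwise estimators; the BEC-BSC region
    follows by evaluating its single-letter terms. *)
Lemma wiretap_achievable (R : realType) (X S1 S2 T1 T2 Y1 Y2 : finType)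
    (ch : isac_channel R X S1 S2 Y1 Y2) (d1 : S1 -> T1 -> R) (d2 : S2 -> T2 -> R)
    (P : X -> R) (h1 : X -> Y1 -> Y2 -> T1) (h2 : X -> Y1 -> Y2 -> T2)
    (r D1 D2 : R) :
  is_pmf P -> 0 <= r ->
  r <= channel_info P (receiver_channel ch) - channel_info P (eavesdropper_channel ch) ->
  \sum_x P x * (\sum_z letter_law ch x z * d1 z.1.1 (h1 x z.2.1 z.2.2)) <= D1 ->
  \sum_x P x * (\sum_z letter_law ch x z * d2 z.1.2 (h2 x z.2.1 z.2.2)) <= D2 ->
  achievable ch d1 d2 r D1 D2.
Proof.
move=> P_pmf r0 hr hD1 hD2; split => // delta d0.
have [n [M [K [C [[n0 C0 rate] [err div dist1 dist2]]]]]] :=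
  exists_wiretap_codebook
    (fun x => \sum_z letter_law ch x z * d1 z.1.1 (h1 x z.2.1 z.2.2))
    (fun x => \sum_z letter_law ch x z * d2 z.1.2 (h2 x z.2.1 z.2.2))
    P_pmf (observed_channel_pmf ch fst fst) (observed_channel_pmf ch snd snd)
    d0 hr.
exists n, (codebook_code ch C h1 h2); split=> //; split.
- by rewrite /code_rate card_ord.
- by rewrite codebook_code_error.
- exact: le_trans (codebook_code_leakage ch h1 h2 P_pmf C0) div.
- apply: le_trans (le_trans dist1 _); last by rewrite lerD2r.
  by rewrite /distortion1 -(codebook_code_distortion ch C h1 h2 fst h1 d1).
- apply: le_trans (le_trans dist2 _); last by rewrite lerD2r.
  by rewrite /distortion2 -(codebook_code_distortion ch C h1 h2 snd h2 d2).
Qed.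

(** Connects the mutual information in [more_capable] with the divergence form used for coding. *)
Lemma single_letter_info (R : realType) (X S1 S2 Y1 Y2 S Y : finType)
    (ch : isac_channel R X S1 S2 Y1 Y2) (P : X -> R)
    (f : S1 * S2 -> S) (g : Y1 * Y2 -> Y) : is_pmf P ->
  mutual_info (single_letter_law ch P) (fun w => w.1.1)
    (fun w => (g w.2, f w.1.2)) = channel_info P (observed_channel ch f g).
Proof.
move=> [P0 P1].
have law (E : X -> (S1 * S2) * (Y1 * Y2) -> bool) :
    Pr (single_letter_law ch P) [pred w | E w.1.1 (w.1.2, w.2)] =
    \sum_x P x * \sum_(z | E x z) letter_law ch x z.
  rewrite /Pr big_mkcond (reindex (fun p : X * ((S1 * S2) * (Y1 * Y2)) =>
    (p.1, p.2.1, p.2.2))) /=; last first.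
    by exists (fun w => (w.1.1, (w.1.2, w.2))) => [[? []]|[[]]].
  under [RHS]eq_bigr do rewrite mulr_sumr big_mkcond /=.
  rewrite pair_bigA /=; apply: eq_bigr => -[x [s y]] _ /=.
  by rewrite /letter_law mulrA.
have pab a b : Pr (single_letter_law ch P)
    [pred w | (w.1.1 == a) && ((g w.2, f w.1.2) == b)] =
    P a * observed_channel ch f g a b.
  rewrite (law (fun x z => (x == a) && ((g z.2, f z.1) == b))).
  rewrite (bigD1 a) //= eqxx /= [X in _ + X]big1 ?addr0 => [|x /negbTE ->]; last first.
    by rewrite big_pred0 ?mulr0.
  congr (_ * _); apply: eq_bigl => z; case: b => y s.
  by rewrite xpair_eqE andbC.
have pa a : Pr (single_letter_law ch P) [pred w | w.1.1 == a] = P a.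
  rewrite (law (fun x z => x == a)).
  rewrite (bigD1 a) //= eqxx letter_law_sum1 mulr1 [X in _ + X]big1 ?addr0 => // x /negbTE ->.
  by rewrite big_pred0 ?mulr0.
have pb b : Pr (single_letter_law ch P) [pred w | (g w.2, f w.1.2) == b] =
    output_dist P (observed_channel ch f g) b.
  rewrite (law (fun x z => (g z.2, f z.1) == b)); apply: eq_bigr => x _.
  congr (_ * _); apply: eq_bigl => z; case: b => y s.
  by rewrite xpair_eqE andbC.
apply: eq_bigr => a _; apply: eq_bigr => b _.
rewrite /= pab pa pb -mulrA.
have [->|Pa] := eqVneq (P a) 0; first by rewrite !mul0r.
by rewrite -mulf_div divff // mul1r.
Qed.

Section StateKnownAtReceiver.
Context (R : realType) (X Y S : finType).
Variables (P : X -> R) (mu : S -> R) (B : S -> X -> Y -> R).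
Hypothesis P_pmf : is_pmf P.

(** The state is independent of the input, so its probability cancels in the ratio [W / Q] and
    information averages over the states. *)
Lemma channel_info_state (W : X -> Y * S -> R) :
  (forall x y s, W x (y, s) = mu s * B s x y) ->
  channel_info P W = \sum_s mu s * channel_info P (B s).
Proof.
move=> WE.
have QE y s : output_dist P W (y, s) = mu s * output_dist P (B s) y.
  by rewrite mulr_sumr; apply: eq_bigr => x _; rewrite WE mulrCA.
rewrite /channel_info; under [RHS]eq_bigr do rewrite mulr_sumr.
rewrite [RHS]exchange_big /=; apply: eq_bigr => x _.
under [RHS]eq_bigr do rewrite mulr_sumr.
rewrite [RHS]exchange_big pair_bigA /=; apply: eq_bigr => -[y s] _ /=.
rewrite WE QE; have [->|ps] := eqVneq (mu s) 0; first by rewrite !mul0r mulr0.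
by rewrite -mulf_div divff // mul1r; ring.
Qed.

Lemma channel_info_cst (w : Y -> R) : channel_info P (fun=> w) = 0.
Proof.
apply: big1 => x _; apply: big1 => y _.
rewrite /output_dist -mulr_suml; case: P_pmf => _ ->; rewrite mul1r.
have [->|wy] := eqVneq (w y) 0; first by rewrite mul0r mulr0.
by rewrite divff // ln1 !mulr0.
Qed.

End StateKnownAtReceiver.

Section BinaryChannels.
Context (R : realType) (P : bool -> R) (gamma beta : R).
Hypothesis P_pmf : is_pmf P.
Hypothesis gamma01 : 0 < gamma < 1.
Hypothesis beta_half : 0 < beta <= 2^-1.

Lemma bool_pmf_false : P false = 1 - P true.
Proof. by case: P_pmf => _; rewrite big_bool /= => <-; rewrite addrC addrK. Qed.

Lemma bool_pmf_ge0 : 0 <= P true.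
Proof. by case: P_pmf. Qed.

Lemma bool_pmf_le1 : P true <= 1.
Proof. by rewrite -subr_ge0 -bool_pmf_false; case: P_pmf. Qed.

(** The erasure symbol has density ratio [1] and carries no information; an unerased output reveals
    the input. *)
Lemma BEC_info : channel_info P (BEC gamma) = (1 - gamma) * Hb (P true).
Proof.
have [g0 g1] : gamma != 0 /\ 1 - gamma != 0.
  by case/andP: gamma01 => *; rewrite !gt_eqF ?subr_gt0.
rewrite /channel_info /output_dist big_bool !sum_option !big_bool /=.
rewrite !mulr0 !addr0 !add0r !mul0r !mulr0 !addr0 !add0r.
have -> : P true * gamma + P false * gamma = gamma.
  by rewrite bool_pmf_false; ring.
rewrite divff // ln1 !mulr0 !add0r.
have E x : P x * ((1 - gamma) * ln ((1 - gamma) / (P x * (1 - gamma)))) =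
    - ((1 - gamma) * (P x * ln (P x))).
  have [->|Px] := eqVneq (P x) 0; first by rewrite !mul0r mulr0 oppr0.
  have {}Px : 0 < P x by rewrite lt_neqAle eq_sym Px P_pmf.1.
  have -> : (1 - gamma) / (P x * (1 - gamma)) = (P x)^-1 by field; rewrite g1 gt_eqF.
  by rewrite lnV ?posrE //; ring.
by rewrite !E /Hb -bool_pmf_false; ring.
Qed.

(** Since [0 < beta < 1], both output probabilities are positive even for a deterministic input, so
    the logarithms of quotients split. *)
Lemma BSC_info :
  channel_info P (BSC beta) = Hb (bconv (P true) beta) - Hb beta.
Proof.
have [p0 p1] := (bool_pmf_ge0, bool_pmf_le1).
case/andP: beta_half => b0 bh; have b1 : 0 < 1 - beta by lra.
have y0 : 0 < bconv (P true) beta by rewrite /bconv; nra.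
have y1 : 0 < 1 - bconv (P true) beta by rewrite /bconv; nra.
rewrite /channel_info /output_dist !big_bool /BSC /=.
have -> : P true * (1 - beta) + P false * beta = bconv (P true) beta.
  by rewrite bool_pmf_false /bconv; ring.
have -> : P true * beta + P false * (1 - beta) = 1 - bconv (P true) beta.
  by rewrite bool_pmf_false /bconv; ring.
rewrite !ln_div ?posrE // bool_pmf_false /Hb.
set l1 := ln (bconv _ _); set l2 := ln (1 - bconv _ _).
by rewrite /bconv; ring.
Qed.

End BinaryChannels.

(** * Single-letter information and distortions of the BEC-BSC channel *)

Section BecBsc.
Context (R : realType) (q alpha gamma beta : R).
Context (hq : 0 <= q <= 1) (halpha : 0 <= alpha <= 1)
    (hgamma : 0 < gamma < 1) (hbeta : 0 < beta <= 2^-1).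
Local Notation ch := (bec_bsc hq halpha hgamma hbeta).

Lemma sum_letters (F : (bool * bool) * (option bool * bool) -> R)
    (p : pred ((bool * bool) * (option bool * bool))) :
  \sum_(z | p z) F z = \sum_s1 \sum_s2 \sum_y1 \sum_y2
    if p ((s1, s2), (y1, y2)) then F ((s1, s2), (y1, y2)) else 0.
Proof.
rewrite big_mkcond /= sum_pair sum_pair; apply: eq_bigr => s1 _.
by apply: eq_bigr => s2 _; rewrite sum_pair.
Qed.

Lemma bec_bsc_receiver x y s : receiver_channel ch x (y, s) =
  (if s then q else 1 - q) * BEC gamma (s && x) y.
Proof.
rewrite /receiver_channel /observed_channel sum_letters !big_bool !sum_option !big_bool.
rewrite /letter_law /= /bec_bsc_state /bec_bsc_output /BSC.
by case: s x y => -[] [[]|] /=; ring.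
Qed.

Lemma bec_bsc_eavesdropper x y s : eavesdropper_channel ch x (y, s) =
  (if s then q * alpha else 1 - q * alpha) * BSC beta (s && x) y.
Proof.
rewrite /eavesdropper_channel /observed_channel sum_letters !big_bool !sum_option !big_bool.
rewrite /letter_law /= /bec_bsc_state /bec_bsc_output /BEC.
by case: s x y => -[] [] /=; ring.
Qed.

Lemma bec_bsc_receiver_info (P : bool -> R) : is_pmf P ->
  channel_info P (receiver_channel ch) = q * ((1 - gamma) * Hb (P true)).
Proof.
move=> P_pmf.
rewrite (channel_info_state P bec_bsc_receiver) big_bool /= (BEC_info P_pmf) //.
by rewrite (channel_info_cst P_pmf) mulr0 addr0.
Qed.

Lemma bec_bsc_eavesdropper_info (P : bool -> R) : is_pmf P ->
  channel_info P (eavesdropper_channel ch) =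
  q * alpha * (Hb (bconv (P true) beta) - Hb beta).
Proof.
move=> P_pmf.
rewrite (channel_info_state P bec_bsc_eavesdropper) big_bool /= (BSC_info P_pmf) //.
by rewrite (channel_info_cst P_pmf) mulr0 addr0.
Qed.

(** With [x = 1] an unerased output equals the state; otherwise the a priori likelier value is
    guessed, which is [true] exactly when [q >= 1 / 2]. *)
Definition estimate1 (x : bool) (y1 : option bool) (y2 : bool) : bool :=
  if x then odflt (~~ (q < 1 - q)) y1 else ~~ (q < 1 - q).

Lemma estimate1_cost x :
  \sum_z letter_law ch x z * hamming z.1.1 (estimate1 x z.2.1 z.2.2) =
  (if x then gamma else 1) * Num.min q (1 - q).
Proof.
rewrite sum_letters !big_bool !sum_option !big_bool.
rewrite /letter_law /= /bec_bsc_state /bec_bsc_output /BEC /BSC /hamming /estimate1.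
rewrite minElt; case: (q < 1 - q); case: x => /=; ring.
Qed.

(** For [x = 1] the thresholds compare the prior with the channel noise: one trusts [y2] only when
    neither state value is rarer than a bit flip, and then errs with probability [beta]. *)
Definition estimate2 (x : bool) (y1 : option bool) (y2 : bool) : bool :=
  if x then
    if q * alpha <= beta then false else if q * alpha <= 1 - beta then y2 else true
  else ~~ (q * alpha < 1 - q * alpha).

Lemma estimate2_cost x :
  \sum_z letter_law ch x z * hamming z.1.2 (estimate2 x z.2.1 z.2.2) =
  if x then
    if q * alpha <= beta then q * alpha
    else if q * alpha <= 1 - beta then beta else 1 - q * alpha
  else Num.min (q * alpha) (1 - q * alpha).
Proof.
rewrite sum_letters !big_bool !sum_option !big_bool.
rewrite /letter_law /= /bec_bsc_state /bec_bsc_output /BEC /BSC /hamming /estimate2.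
rewrite minElt; case: x => /=.
  by case: (q * alpha <= beta); [|case: (q * alpha <= 1 - beta)]; rewrite /=; ring.
by case: (q * alpha < 1 - q * alpha); rewrite /=; ring.
Qed.

End BecBsc.

(** * The entropy inequality behind more-capability *)

Lemma le_of_derive_ge0 (R : realType) (f df : R -> R) (a b : R) : a <= b ->
  (forall x, a <= x <= b -> is_derive x 1 f (df x)) ->
  (forall x, a <= x <= b -> 0 <= df x) -> f a <= f b.
Proof.
move=> ab fdf df0.
have [||c] := MVT_segment ab (f := f) (df := df).
- by move=> x; rewrite in_itv /= => /andP[/ltW ax /ltW xb]; apply: fdf; rewrite ax xb.
- apply: derivable_within_continuous => x; rewrite in_itv /= => xab.
  by have [] := fdf x xab.
rewrite in_itv /= => cab fE; rewrite -subr_ge0 fE mulr_ge0 ?subr_ge0 //.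
exact: df0.
Qed.

Section BinaryEntropy.
Context (R : realType).
Implicit Types x p beta : R.

Lemma Hb_ge0 x : 0 <= x <= 1 -> 0 <= Hb x.
Proof.
move=> /andP[x0 x1]; rewrite /Hb.
have h1 : x * ln x <= 0 by rewrite mulr_ge0_le0 // ln_le0.
have h2 : (1 - x) * ln (1 - x) <= 0.
  by rewrite mulr_ge0_le0 ?subr_ge0 // ln_le0 // gerBl.
lra.
Qed.

Lemma Hb_sym x : Hb (1 - x) = Hb x.
Proof. by rewrite /Hb opprB addrCA subrr addr0; ring. Qed.

(** Each term satisfies [- t * ln t <= 1 - t], and the two right-hand sides add up to [1]. The
    constant [1] matches the factor [1 - Hb beta] below. *)
Lemma Hb_le1 x : 0 <= x <= 1 -> Hb x <= 1.
Proof.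
move=> /andP[x0 x1]; rewrite /Hb.
have h1 := @sub_le_mul_ln_div R x 1 x0 ler01.
have h2 := @sub_le_mul_ln_div R (1 - x) 1.
rewrite divr1 in h1; rewrite divr1 subr_ge0 in h2.
have {}h1 := h1 ltac:(by move/eqP; rewrite oner_eq0).
have {}h2 := h2 x1 ler01 ltac:(by move/eqP; rewrite oner_eq0).
lra.
Qed.

Lemma is_derive_lnB x : x < 1 ->
  is_derive x 1 (fun t : R => ln (1 - t)) (- (1 - x)^-1).
Proof.
move=> x1; have h : is_derive x 1 (fun t : R => 1 - t) (-1).
  by apply: is_derive_eq; ring.
have x1' : 0 < 1 - x by lra.
have := @is_derive1_comp R (@ln R) (fun t => 1 - t) x _ _ (is_derive1_ln x1') h.
by rewrite mulrN1.
Qed.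

Lemma is_derive_Hb x : 0 < x < 1 -> is_derive x 1 (@Hb R) (ln (1 - x) - ln x).
Proof.
move=> /andP[x0 x1]; have d1 := is_derive1_ln x0; have d2 := is_derive_lnB x1.
have -> : @Hb R = (fun t => - (t * ln t) - (1 - t) * ln (1 - t)).
  by apply/funext => t; rewrite /Hb mulNr.
apply: is_derive_eq; rewrite /GRing.scale /=.
by field; rewrite !gt_eqF ?subr_gt0.
Qed.

Lemma is_derive_affine_comp (f : R -> R) (df a b x : R) :
  is_derive (a * x + b) 1 f df -> is_derive x 1 (fun t => f (a * t + b)) (a * df).
Proof.
move=> fd; have h : is_derive x 1 (fun t : R => a * t + b) a.
  by apply: is_derive_eq; rewrite /GRing.scale /=; ring.
by have := @is_derive1_comp R f (fun t => a * t + b) x _ _ fd h; rewrite mulrC.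
Qed.

Lemma bconvE p beta : bconv p beta = (1 - 2 * beta) * p + beta.
Proof. by rewrite /bconv; ring. Qed.

(* The difference [f] of the two sides has [f'(1/2) = 0], and the numerator [N]
   of [f''] increases on [(0, 1/2]]: [f] is concave and then convex, so it
   decreases where [f' <= 0], down to [f(1/2) >= 0], and elsewhere it increases
   from [f(0+) >= 0]. *)
Lemma Hb_bconv_le (p beta : R) : 0 <= p <= 1 -> 0 < beta <= 2^-1 ->
  Hb (bconv p beta) - Hb beta <= (1 - Hb beta) * Hb p.
Proof.
(* Replacing [p] by [1 - p] replaces [bconv p beta] by [1 - bconv p beta], and [Hb] is invariant
   under this symmetry. *)
wlog p_half : p / p <= 2^-1.
  move=> H hp hb; have [p2|p2] := leP p 2^-1; first exact: H.
  have := H (1 - p); rewrite Hb_sym.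
  have -> : bconv (1 - p) beta = 1 - bconv p beta by rewrite /bconv; ring.
  by rewrite Hb_sym; apply => //; lra.
move=> /andP[p0 _] /andP[b0 b_half].
have [->|pn0] := eqVneq p 0.
  rewrite /bconv mul0r subr0 mul1r add0r subrr; apply: mulr_ge0.
    by rewrite subr_ge0 Hb_le1 //; lra.
  by apply: Hb_ge0; lra.
have {p0 pn0}p0 : 0 < p by rewrite lt_neqAle eq_sym pn0.
set c : R := 1 - Hb beta; set k : R := 1 - 2 * beta.
have hb01 : 0 <= beta <= 1 by lra.
have c0 : 0 <= c by rewrite subr_ge0 Hb_le1.
have c1 : c <= 1 by rewrite gerBl Hb_ge0.
have k0 : 0 <= k by rewrite /k; lra.
pose y (t : R) : R := k * t + beta.
pose f (t : R) : R := c * Hb t - Hb (y t).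
pose g (t : R) : R := c * (ln (1 - t) - ln t) - k * (ln (1 - y t) - ln (y t)).
pose dg (t : R) : R := c * (- (1 - t)^-1 - t^-1) - k * (k * (- (1 - y t)^-1 - (y t)^-1)).
have y01 (t : R) : 0 < t <= 2^-1 -> 0 < y t < 1.
  by move=> /andP[t0 t1]; rewrite /y /k; apply/andP; split; nra.
have fd (t : R) : 0 < t <= 2^-1 -> is_derive t 1 f (g t).
  move=> ht; have d1 : is_derive t 1 (@Hb R) (ln (1 - t) - ln t) by apply: is_derive_Hb; lra.
  have d2 := is_derive_affine_comp (is_derive_Hb (y01 _ ht)).
  by rewrite /f; apply: is_derive_eq; rewrite /g /GRing.scale /=; ring.
have gd (t : R) : 0 < t <= 2^-1 -> is_derive t 1 g (dg t).
  move=> ht; have [t0 t1] : 0 < t /\ t < 1 by lra.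
  have /andP[yt0 yt1] := y01 _ ht.
  have d1 := is_derive1_ln t0; have d2 := is_derive_lnB t1.
  have d3 := is_derive_affine_comp (is_derive1_ln yt0).
  have d4 := is_derive_affine_comp (is_derive_lnB yt1).
  by rewrite /g; apply: is_derive_eq; rewrite /dg /GRing.scale /=; ring.
pose N (t : R) : R := k ^+ 2 * (t * (1 - t)) - c * (beta * (1 - beta) + k ^+ 2 * (t * (1 - t))).
have dgE (t : R) : 0 < t <= 2^-1 -> dg t = N t / (t * (1 - t) * (y t * (1 - y t))).
  move=> ht; have /andP[yt0 yt1] := y01 _ ht; have [t0 t1] : 0 < t /\ t < 1 by lra.
  have -> : N t = k ^+ 2 * (t * (1 - t)) - c * (y t * (1 - y t)).
    by rewrite /N /y /k; ring.
  by rewrite /dg; field; rewrite !gt_eqF ?subr_gt0.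
have den0 (t : R) : 0 < t <= 2^-1 -> 0 < t * (1 - t) * (y t * (1 - y t)).
  move=> ht; have /andP[yt0 yt1] := y01 _ ht.
  by rewrite !mulr_gt0 ?subr_gt0 //; lra.
have N_mono (s t : R) : 0 < s -> s <= t -> t <= 2^-1 -> N s <= N t.
  move=> s0 st t2; rewrite -subr_ge0.
  have -> : N t - N s = k ^+ 2 * (1 - c) * ((t - s) * (1 - t - s)) by rewrite /N; ring.
  by rewrite !mulr_ge0 ?sqr_ge0 ?subr_ge0 //; lra.
have g_half : g 2^-1 = 0.
  rewrite /g.
  have -> : 1 - 2^-1 = 2^-1 :> R by field.
  have -> : y 2^-1 = 2^-1 by rewrite /y /k; field.
  have -> : 1 - 2^-1 = 2^-1 :> R by field.
  by rewrite !subrr !mulr0 subr0.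
(* As [N] is monotone, [N t >= 0] makes [g] nondecreasing from [t] up to [1 / 2], where it
   vanishes. *)
have g_le0 (t : R) : 0 < t <= 2^-1 -> 0 <= N t -> g t <= 0.
  move=> /andP[t0 t2] Nt; rewrite -g_half.
  apply: (le_of_derive_ge0 (df := dg) t2) => x /andP[tx x2].
    by apply: gd; rewrite (lt_le_trans t0).
  have hx : 0 < x <= 2^-1 by rewrite (lt_le_trans t0).
  by rewrite dgE // divr_ge0 ?(ltW (den0 _ hx)) // (le_trans Nt) // N_mono.
have g_nincr (s t : R) : 0 < s -> s <= t -> t <= 2^-1 -> N t <= 0 -> g t <= g s.
  move=> s0 st t2 Nt; rewrite -lerN2.
  apply: (le_of_derive_ge0 (f := fun x => - g x) (df := fun x => - dg x) st) => x /andP[sx xt].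
    have hx : 0 < x <= 2^-1 by rewrite (lt_le_trans s0) // (le_trans xt).
    by have d := gd x hx; apply: is_derive_eq.
  have hx : 0 < x <= 2^-1 by rewrite (lt_le_trans s0) // (le_trans xt).
  rewrite dgE // -mulNr divr_ge0 ?(ltW (den0 _ hx)) // oppr_ge0 (le_trans _ Nt) //.
  by rewrite N_mono // (lt_le_trans s0).
have f_half : - Hb beta <= f 2^-1.
  rewrite /f.
  have -> : y 2^-1 = 2^-1 by rewrite /y /k; field.
  have : Hb 2^-1 <= 1 :> R by apply: Hb_le1; lra.
  have : 0 <= Hb beta by exact: Hb_ge0.
  rewrite /c; nra.
(* Here [f] omits the constant [Hb beta], so the threshold is [- Hb beta] instead of [0]. *)
suff : - Hb beta <= f p by rewrite /f bconvE -/k -/(y p); lra.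
have [gp|gp] := leP (g p) 0.
  apply: (le_trans f_half); rewrite -lerN2.
  apply: (le_of_derive_ge0 (f := fun x => - f x) (df := fun x => - g x) p_half) => x /andP[px x2].
    have hx : 0 < x <= 2^-1 by rewrite (lt_le_trans p0).
    by have d := fd x hx; apply: is_derive_eq.
  rewrite oppr_ge0; have [Nx|Nx] := leP 0 (N x).
    by apply: g_le0 => //; rewrite (lt_le_trans p0).
  by apply: le_trans gp; apply: g_nincr => //; exact: ltW.
(* A positive slope at [p] is incompatible with [N p >= 0]; hence [f] is concave on the whole of
   [(0, p]] and its slope there is at least [g p]. *)
have Np : N p <= 0.
  by rewrite leNgt; apply/negP => /ltW /g_le0; rewrite p0 p_half leNgt gp => /(_ isT).
have f_eps (e : R) : 0 < e -> e <= p -> f e <= f p.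
  move=> e0 ep; apply: (le_of_derive_ge0 (df := g) ep) => x /andP[ex xp].
    by apply: fd; rewrite (lt_le_trans e0) // (le_trans xp).
  by apply: le_trans (ltW gp) _; apply: g_nincr => //; rewrite (lt_le_trans e0).
pose L := ln (1 - beta) - ln beta.
have L0 : 0 <= L by rewrite subr_ge0 ler_ln ?posrE; lra.
(* Gibbs: [Hb (y e)] is at most the cross entropy of [y e] and [beta]. *)
have f_lower (e : R) : 0 < e <= 2^-1 -> - Hb beta - L * e <= f e.
  move=> he; have /andP[ye0 ye1] := y01 _ he.
  have ye1' : 0 < 1 - y e by lra.
  have b1' : 0 < 1 - beta by lra.
  have h1 := @sub_le_mul_ln_div R (y e) beta (ltW ye0) (ltW b0).
  have h2 := @sub_le_mul_ln_div R (1 - y e) (1 - beta) (ltW ye1') (ltW b1').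
  rewrite ln_div ?posrE // in h1; rewrite ln_div ?posrE // in h2.
  have {}h1 := h1 ltac:(by move=> E; rewrite E ltxx in b0).
  have {}h2 := h2 ltac:(by move=> E; rewrite E ltxx in b1').
  have h3 : 0 <= c * Hb e by rewrite mulr_ge0 // Hb_ge0 //; lra.
  have h4 : Hb (y e) <= Hb beta + (y e - beta) * L.
    rewrite /L {2}/Hb /Hb; nra.
  have h5 : (y e - beta) * L <= L * e.
    have -> : y e - beta = k * e by rewrite /y; ring.
    case/andP: he => /ltW e0 _.
    rewrite -mulrA [L * e]mulrC -[leRHS]mul1r ler_wpM2r ?mulr_ge0 //.
    by rewrite /k; lra.
  rewrite /f; lra.
rewrite leNgt; apply/negP => fp.
(* This replaces the limit at [0]: [L * e] is at most half the assumed gap, so [f_lower] gives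
   [f e > f p], against [f_eps]. Adding [1] to [L] keeps the denominator positive when
   [beta = 1 / 2]. *)
pose e := Num.min p ((- Hb beta - f p) / (2 * (L + 1))).
have e0 : 0 < e by rewrite lt_min p0 divr_gt0 //; lra.
have ep : e <= p by rewrite ge_min lexx.
have eL : e * (2 * (L + 1)) <= - Hb beta - f p.
  by rewrite -ler_pdivlMr; [rewrite ge_min lexx orbT|lra].
have := f_eps e e0 ep; have := f_lower e; rewrite e0 (le_trans ep) // => /(_ isT).
nra.
Qed.

End BinaryEntropy.

(** * More-capability and the inner bound *)

Lemma bernoulli_is_pmf (R : realType) (p : R) : 0 <= p <= 1 ->
  is_pmf (fun x : bool => if x then p else 1 - p).
Proof.
move=> /andP[p0 p1]; split; first by case; rewrite ?subr_ge0.
by rewrite big_bool /= addrC subrK.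
Qed.

(** In the middle regime the estimator [y2] costs only [beta]; the difference
    [2 * a * (1 - a) * (1 - 2 * beta)] shows that the stated distortion is no smaller. *)
Lemma le_bconv_self (R : realType) (a beta : R) : 0 <= a <= 1 -> beta <= 2^-1 ->
  beta <= bconv (bconv a beta) a.
Proof.
move=> /andP[a0 a1] bh; rewrite -subr_ge0.
have -> : bconv (bconv a beta) a - beta = 2 * (a * (1 - a) * (1 - 2 * beta)).
  by rewrite /bconv; ring.
by rewrite !mulr_ge0 ?subr_ge0 //; lra.
Qed.

Theorem lemma3 (R : realType) (q alpha gamma beta : R)
    (hq : 0 <= q <= 1) (halpha : 0 <= alpha <= 1)
    (hgamma : 0 < gamma < 1) (hbeta : 0 < beta <= 2^-1)
    (hmc : gamma <= 1 - alpha * (1 - Hb beta)) :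
  let ch := bec_bsc hq halpha hgamma hbeta in
  more_capable ch /\
  \bigcup_(p in [set p : R | 0 <= p <= 1])
    [set t : R * R * R |
      let: (r, D1, D2) := t in
      [/\ 0 <= r,
          r <= q * (Hb p * (1 - gamma)
                    + alpha * (Hb beta - Hb (bconv p beta))),
          (1 - p + p * gamma) * Num.min q (1 - q) <= D1
        & (1 - p) * Num.min (q * alpha) (1 - q * alpha)
          + p * (if q * alpha <= beta then q * alpha
                 else if q * alpha <= 1 - beta
                 then bconv (bconv (q * alpha) beta) (q * alpha)
                 else 1 - q * alpha) <= D2]]
  `<=` region_POF ch hamming hamming.
Proof.
move=> ch; have /andP[q0 q1] := hq; have /andP[a0 a1] := halpha.
have /andP[b0 bh] := hbeta; split.
  move=> PX PX_pmf /=.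
  suff : channel_info PX (eavesdropper_channel ch) <= channel_info PX (receiver_channel ch).
    by rewrite -!(single_letter_info ch _ _ PX_pmf).
  rewrite bec_bsc_receiver_info // bec_bsc_eavesdropper_info // -mulrA ler_wpM2l //.
  have p01 : 0 <= PX true <= 1 by rewrite bool_pmf_ge0 // bool_pmf_le1.
  (* The entropy inequality bounds the eavesdropper's information by a multiple of [Hb (PX true)];
     [hmc] says that this multiple is at most [1 - gamma]. *)
  apply: (@le_trans _ _ (alpha * ((1 - Hb beta) * Hb (PX true)))).
    by rewrite ler_wpM2l // Hb_bconv_le.
  by rewrite mulrA ler_wpM2r ?Hb_ge0 //; lra.
move=> [[r D1] D2] [p /= p01 [r0 hr hD1 hD2]]; apply: subset_closure => /=.
have /andP[p0 p1] := p01.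
have P_pmf := bernoulli_is_pmf p01.
apply: (wiretap_achievable (h1 := estimate1 q) (h2 := estimate2 q alpha beta) P_pmf) => //.
- rewrite bec_bsc_receiver_info // bec_bsc_eavesdropper_info //=.
  by apply: (le_trans hr); rewrite le_eqVlt; apply/orP; left; apply/eqP; ring.
- rewrite big_bool /= !estimate1_cost mul1r; apply: le_trans hD1.
  by rewrite le_eqVlt; apply/orP; left; apply/eqP; ring.
- rewrite big_bool /= !estimate2_cost; apply: le_trans hD2.
  rewrite addrC lerD2l ler_wpM2l //.
  case: ifP => // _; case: ifP => // _; apply: le_bconv_self => //.
  by rewrite mulr_ge0 //= mulr_ile1.
Qed.
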